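(* Let $\mathbb{K}$ be a field, let $\mathcal{C}$ be a chordal clutter with vertex set $V(\mathcal{C})=\{v_1,\dots,v_n\}$, and let $S=\mathbb{K}[x_1,\dots,x_n]$. Let $d\geq 1$ be an integer and assume that the minimum edge cardinality of $\mathcal{C}$ is at least $d$ (i.e. every edge of $\mathcal{C}$ has at least $d$ elements). Then $S/I(c_d(\mathcal{C}))$ satisfies Stanley's conjecture, that is, $${\rm depth}(S/I(c_d(\mathcal{C})))\leq {\rm sdepth}(S/I(c_d(\mathcal{C}))).$$
   Context: A clutter $\mathcal{C}$ with finite vertex set $V(\mathcal{C})$ is a set $E(\mathcal{C})$ of subsets of $V(\mathcal{C})$, called edges, such that no edge contains another. For a vertex $v$ of $\mathcal{C}$, the deletion $\mathcal{C}\setminus\{v\}$ is the clutter with vertex set $V(\mathcal{C})\setminus\{v\}$ and edge set $\{e\in E(\mathcal{C}): v\notin e\}$; the contraction $\mathcal{C}/\{v\}$ is the clutter with vertex set $V(\mathcal{C})\setminus\{v\}$ whose edges are the minimal elements (under inclusion) of $\{e\setminus\{v\}: e\in E(\mathcal{C})\}$. A minor of $\mathcal{C}$ is a clutter obtained from $\mathcal{C}$ by a (possibly empty) sequence of deletions and/or contractions. A vertex $v$ of a clutter is simplicial if for every two distinct edges $e_1,e_2$ containing $v$ there is an edge $e_3$ with $e_3\subseteq (e_1\cup e_2)\setminus\{v\}$. A clutter is chordal if every minor of it (with nonempty vertex set) has a simplicial vertex. For $d\geq 1$, the $d$-complement $c_d(\mathcal{C})$ is the clutter with vertex set $V(\mathcal{C})$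 and edge set $\{e\subseteq V(\mathcal{C}): |e|=d \text{ and } e\notin E(\mathcal{C})\}$. For a clutter $\mathcal{D}$ with vertex set $\{v_1,\dots,v_n\}$, the edge ideal is $I(\mathcal{D})=(x_e: e\in E(\mathcal{D}))\subseteq \mathbb{K}[x_1,\dots,x_n]$, where $x_e=\prod_{v_i\in e}x_i$. Stanley depth: let $M$ be a nonzero finitely generated $\mathbb{Z}^n$-graded $S$-module. For a homogeneous $u\in M$ and $Z\subseteq\{x_1,\dots,x_n\}$, the $\mathbb{K}$-subspace $u\mathbb{K}[Z]$ generated by all $uv$ with $v\in\mathbb{K}[Z]$ is called a Stanley space of dimension $|Z|$ if it is a free $\mathbb{K}[Z]$-module. A Stanley decomposition $\mathcal{D}$ of $M$ is a decomposition of $M$ as a finite direct sum of Stanley spaces; ${\rm sdepth}(\mathcal{D})$ is the minimum dimension of a Stanley space in $\mathcal{D}$, and ${\rm sdepth}(M)$ is the maximum of ${\rm sdepth}(\mathcal{D})$ over all Stanley decompositions $\mathcal{D}$ of $M$. *)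

(* Defs.v *)
From HB Require Import structures.
From mathcomp Require Import all_boot all_order all_algebra.
From mathcomp Require Import boolp.
From mathcomp Require Import mpoly.

Set Implicit Arguments.
Unset Strict Implicit.
Unset Printing Implicit Defensive.

Import GRing.Theory.

Local Open Scope ring_scope.
Local Open Scope quotient_scope.

(** * Clutters *)

(* The ambient finite type [T] is a universe of possible vertices: minors live
   on smaller vertex sets, still inside [T]. *)
Record clutter (T : finType) := Clutter {
  vset : {set T};
  edges : {set {set T}};
  edges_sub : forall e, e \in edges -> e \subset vset;
  edges_antichain :
    forall e1 e2, e1 \in edges -> e2 \in edges -> e1 \subset e2 -> e1 = e2
}.

Section Clutters.
Variable T : finType.
Implicit Types (C D : clutter T) (v : T) (e : {set T}).

Definition del_edges C v := [set e in edges C | v \notin e].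

Lemma del_sub C v e : e \in del_edges C v -> e \subset vset C :\ v.
Proof.
by rewrite inE subsetD1 => /andP[eC ->]; rewrite (edges_sub eC).
Qed.

Lemma del_antichain C v e1 e2 : e1 \in del_edges C v ->
  e2 \in del_edges C v -> e1 \subset e2 -> e1 = e2.
Proof.
by rewrite !inE => /andP[e1C _] /andP[e2C _]; apply: edges_antichain e1C e2C.
Qed.

Definition deletion C v := Clutter (@del_sub C v) (@del_antichain C v).

Definition contr_edges C v :=
  [set e | minset [pred f in [set e' :\ v | e' in edges C]] e].

Lemma contr_sub C v e : e \in contr_edges C v -> e \subset vset C :\ v.
Proof.
rewrite inE => /minsetp/imsetP[e' e'C ->].
exact: setSD (edges_sub e'C).
Qed.

Lemma contr_antichain C v e1 e2 : e1 \in contr_edges C v ->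
  e2 \in contr_edges C v -> e1 \subset e2 -> e1 = e2.
Proof.
by rewrite !inE => /minsetp e1C /minsetP[_ min2]; apply: min2.
Qed.

Definition contraction C v := Clutter (@contr_sub C v) (@contr_antichain C v).

Inductive minor C : clutter T -> Prop :=
  | minor_refl : minor C C
  | minor_del D v : minor C D -> v \in vset D -> minor C (deletion D v)
  | minor_contr D v : minor C D -> v \in vset D -> minor C (contraction D v).

Definition simplicial C v : Prop :=
  forall e1 e2, e1 \in edges C -> e2 \in edges C -> e1 != e2 ->
    v \in e1 -> v \in e2 ->
  exists2 e3, e3 \in edges C & e3 \subset (e1 :|: e2) :\ v.

Definition chordal C : Prop :=
  forall D, minor C D -> vset D != set0 ->
  exists2 v, v \in vset D & simplicial D v.

Definition compl_edges d C :=
  [set e : {set T} | [&& e \subset vset C, #|e| == d & e \notin edges C]].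

Lemma compl_sub d C e : e \in compl_edges d C -> e \subset vset C.
Proof. by rewrite inE => /and3P[]. Qed.

Lemma compl_antichain d C e1 e2 : e1 \in compl_edges d C ->
  e2 \in compl_edges d C -> e1 \subset e2 -> e1 = e2.
Proof.
rewrite !inE => /and3P[_ /eqP c1 _] /and3P[_ /eqP c2 _] e12.
by apply/eqP; rewrite eqEcard e12 c1 c2 leqnn.
Qed.

Definition d_complement d C :=
  Clutter (@compl_sub d C) (@compl_antichain d C).

End Clutters.

(** * Quotient of a module by a submodule *)

(* The library's [{ideal_quot W}] is the quotient by a subgroup [W]; the alias
   [quot_module Wscale] remembers that [W] is stable under scaling, so that the
   quotient is a module. *)
Section QuotientModule.
Variables (R : nzRingType) (V : lmodType R) (W : zmodClosed V).
Hypothesis Wscale : GRing.scaler_closed W.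

Definition quot_module of GRing.scaler_closed W : Type := {ideal_quot W}.
Local Notation Q := (quot_module Wscale).

HB.instance Definition _ := GRing.Zmodule.on Q.

Definition quot_proj (u : V) : Q := \pi_({ideal_quot W}) u.

Lemma quot_proj0 : quot_proj 0 = 0.
Proof. exact: pi_zeror. Qed.

Lemma quot_projD : {morph quot_proj : u w / u + w}.
Proof. exact: pi_addr. Qed.

Lemma quot_projE u w : (quot_proj u = quot_proj w) <-> (u - w \in W).
Proof. by rewrite Quotient.idealrBE; split=> /eqP. Qed.

Lemma quot_proj_surj (x : Q) : exists u, x = quot_proj u.
Proof. by exists (repr (x : {ideal_quot W})); rewrite /quot_proj reprK. Qed.

Definition quot_scale (a : R) (x : Q) : Q :=
  quot_proj (a *: repr (x : {ideal_quot W})).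

Fact quot_scaleE a u : quot_scale a (quot_proj u) = quot_proj (a *: u).
Proof.
apply/quot_projE; rewrite -scalerBr; apply: Wscale.
by apply/quot_projE; rewrite /quot_proj reprK.
Qed.

Fact quot_scalerA a b x :
  quot_scale a (quot_scale b x) = quot_scale (a * b) x.
Proof. by have [u ->] := quot_proj_surj x; rewrite !quot_scaleE scalerA. Qed.

Fact quot_scale1r : left_id 1 quot_scale.
Proof. by move=> x; have [u ->] := quot_proj_surj x; rewrite quot_scaleE scale1r. Qed.

Fact quot_scalerDr : right_distributive quot_scale +%R.
Proof.
move=> a x y; have [u ->] := quot_proj_surj x.
have [w ->] := quot_proj_surj y.
by rewrite -quot_projD !quot_scaleE -quot_projD scalerDr.
Qed.

Fact quot_scalerDl x : {morph quot_scale^~ x : a b / a + b}.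
Proof.
move=> a b; have [u ->] := quot_proj_surj x.
by rewrite !quot_scaleE -quot_projD scalerDl.
Qed.

HB.instance Definition _ := GRing.Zmodule_isLmodule.Build R Q
  quot_scalerA quot_scale1r quot_scalerDr quot_scalerDl.

Lemma quot_projZ a u : quot_proj (a *: u) = a *: quot_proj u.
Proof. by rewrite -quot_scaleE. Qed.

End QuotientModule.

(** * Z^n-graded modules over K[x_1, ..., x_n] *)

Record multigrading (K : fieldType) (n : nat) (M : lmodType {mpoly K[n]}) :=
  Multigrading {
  component : {ffun 'I_n -> int} -> M -> Prop;
  component0 : forall a, component a 0;
  componentD : forall a w1 w2,
    component a w1 -> component a w2 -> component a (w1 + w2);
  componentZ : forall a (c : K) w, component a w -> component a (c%:MP *: w);
  componentX : forall a (m : 'X_{1..n}) w, component a w ->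
    component (a + [ffun i => (m i)%:Z]) ('X_[m] *: w);
  component_span : forall w, exists (A : seq {ffun 'I_n -> int}) f,
    (forall a, component a (f a)) /\ w = \sum_(a <- A) f a;
  component_indep : forall (A : seq {ffun 'I_n -> int}) f,
    uniq A -> (forall a, component a (f a)) -> \sum_(a <- A) f a = 0 ->
    forall a, a \in A -> f a = 0
}.

Definition homogeneous (K : fieldType) n (M : lmodType {mpoly K[n]})
    (G : multigrading M) (u : M) : Prop :=
  exists a, component G a u.

Definition is_max (P : nat -> Prop) (r : nat) : Prop :=
  P r /\ forall k, P k -> (k <= r)%N.

(** * Stanley depth *)

Section StanleyDepth.
Variables (K : fieldType) (n : nat) (M : lmodType {mpoly K[n]}).
Variable G : multigrading M.
Implicit Types (Z : {set 'I_n}) (u : M) (N : M -> Prop).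

Definition poly_in Z (p : {mpoly K[n]}) : Prop :=
  forall m, m \in msupp p -> forall i, m i != 0%N -> i \in Z.

Definition cyclic_span u Z : M -> Prop :=
  fun w => exists2 p, poly_in Z p & w = p *: u.

(* Finite bases suffice, as the definition is only applied to the finitely
   generated modules [cyclic_span u Z]. *)
Definition free_over Z N : Prop :=
  exists (k : nat) (b : 'I_k -> M), (forall j, N (b j)) /\
    forall w, N w -> exists! c : {ffun 'I_k -> {mpoly K[n]}},
      (forall j, poly_in Z (c j)) /\ w = \sum_(j < k) c j *: b j.

Definition stanley_space u Z : Prop :=
  homogeneous G u /\ free_over Z (cyclic_span u Z).

Definition stanley_decomposition k (u : 'I_k -> M) (Z : 'I_k -> {set 'I_n}) :=
  (forall j, stanley_space (u j) (Z j)) /\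
  forall w, exists! f : {ffun 'I_k -> M},
    (forall j, cyclic_span (u j) (Z j) (f j)) /\ w = \sum_(j < k) f j.

(* [n] bounds every [#|Z j|], so starting the minimum at [n] is harmless when
   [0 < k], which always holds if [M] is nonzero. *)
Definition decomposition_sdepth k (Z : 'I_k -> {set 'I_n}) : nat :=
  \big[minn/n]_(j < k) #|Z j|.

Definition has_sdepth : nat -> Prop :=
  is_max (fun s => exists k (u : 'I_k -> M) (Z : 'I_k -> {set 'I_n}),
    stanley_decomposition u Z /\ decomposition_sdepth Z = s).

End StanleyDepth.

(** * Depth *)

(* Depth with respect to the graded maximal ideal (x_1, ..., x_n): the maximal
   length of an M-regular sequence of elements of that ideal. *)
Section Depth.
Variables (K : fieldType) (n : nat) (M : lmodType {mpoly K[n]}).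
Implicit Types (fs : seq {mpoly K[n]}) (w : M).

Definition irrelevant_ideal (f : {mpoly K[n]}) : Prop :=
  exists c : 'I_n -> {mpoly K[n]}, f = \sum_(i < n) c i * 'X_i.

Definition ideal_mul fs w : Prop :=
  exists y : 'I_(size fs) -> M, w = \sum_(j < size fs) fs`_j *: y j.

Definition regular_sequence fs : Prop :=
  (forall i, (i < size fs)%N ->
     forall w, ideal_mul (take i fs) (fs`_i *: w) -> ideal_mul (take i fs) w)
  /\ exists w, ~ ideal_mul fs w.

Definition has_depth : nat -> Prop :=
  is_max (fun r => exists fs, [/\ size fs = r,
    forall f, f \in fs -> irrelevant_ideal f & regular_sequence fs]).

End Depth.

(** * Edge ideals *)

Section EdgeIdeal.
Variables (K : fieldType) (T : finType) (n : nat) (v : 'I_n -> T).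
Variable D : clutter T.

Local Notation S := {mpoly K[n]}.

Definition edge_mon (e : {set T}) : S := \prod_(i < n | v i \in e) 'X_i.

(* [S^o] is [S] as a module over itself (the default module structure on [S]
   is over [K]). *)
Definition edge_ideal : {pred S^o} :=
  fun f => `[< exists c : {set T} -> S,
                 f = \sum_(e in edges D) c e * edge_mon e >].

Lemma edge_idealP (f : S^o) : reflect
  (exists c : {set T} -> S, f = \sum_(e in edges D) c e * edge_mon e)
  (f \in edge_ideal).
Proof. exact: asboolP. Qed.

Fact edge_ideal_submod : submod_closed edge_ideal.
Proof.
split=> [|a f g].
  by apply/edge_idealP; exists (fun=> 0); rewrite big1 // => e _; rewrite mul0r.
move=> /edge_idealP[c ->] /edge_idealP[b ->]; apply/edge_idealP.
exists (fun e => a * c e + b e); rewrite scaler_sumr -big_split /=.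
by apply: eq_bigr => e _; rewrite mulrDl -mulrA.
Qed.

HB.instance Definition _ :=
  GRing.isSubmodClosed.Build S S^o edge_ideal edge_ideal_submod.

Fact edge_ideal_scale : GRing.scaler_closed edge_ideal.
Proof. by move=> a f fI; rewrite rpredZ. Qed.

Definition edge_quot : lmodType S := quot_module edge_ideal_scale.

Definition edge_proj (f : S) : edge_quot := quot_proj edge_ideal_scale f.

Fact edge_projD f g : edge_proj (f + g) = edge_proj f + edge_proj g.
Proof. exact: quot_projD. Qed.

Fact edge_proj0 : edge_proj 0 = 0.
Proof. exact: quot_proj0. Qed.

Fact edge_projM f g : edge_proj (f * g) = f *: edge_proj g.
Proof. exact: (quot_projZ edge_ideal_scale). Qed.

Fact edge_proj_sum I (r : seq I) (F : I -> S) :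
  edge_proj (\sum_(i <- r) F i) = \sum_(i <- r) edge_proj (F i).
Proof. exact: (big_morph _ edge_projD edge_proj0). Qed.

Fact edge_proj_eq0 f : (edge_proj f = 0) <-> (f \in edge_ideal).
Proof. by rewrite -edge_proj0 quot_projE subr0. Qed.

(* The polynomials of multidegree [a]. *)
Definition mdegree (a : {ffun 'I_n -> int}) (f : S) : Prop :=
  forall m, m \in msupp f -> forall i, (m i)%:Z = a i.

Definition edge_component (a : {ffun 'I_n -> int}) (w : edge_quot) : Prop :=
  exists2 f, mdegree a f & w = edge_proj f.

Fact edge_component0 a : edge_component a 0.
Proof. by exists 0; rewrite ?edge_proj0 // => m; rewrite msupp0. Qed.

Fact edge_componentD a w1 w2 : edge_component a w1 -> edge_component a w2 ->
  edge_component a (w1 + w2).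
Proof.
move=> [f fa ->] [g ga ->]; exists (f + g); last by rewrite edge_projD.
by move=> m /msuppD_le; rewrite mem_cat => /orP[/fa|/ga].
Qed.

Fact edge_componentZ a (c : K) w :
  edge_component a w -> edge_component a (c%:MP *: w).
Proof.
move=> [f fa ->]; exists (c%:MP * f); last by rewrite edge_projM.
by move=> m; rewrite mul_mpolyC => /msuppZ_le /fa.
Qed.

Fact edge_componentX a (m : 'X_{1..n}) w : edge_component a w ->
  edge_component (a + [ffun i => (m i)%:Z]) ('X_[m] *: w).
Proof.
move=> [f fa ->]; exists ('X_[m] * f); last by rewrite edge_projM.
move=> m'; rewrite mulrC (perm_mem (msuppMX _ _)) => /mapP[m1 /fa m1a ->] i.
by rewrite mnmDE PoszD m1a !ffunE addrC.
Qed.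

Fact edge_component_span w : exists (A : seq {ffun 'I_n -> int}) f,
  (forall a, edge_component a (f a)) /\ w = \sum_(a <- A) f a.
Proof.
pose dg (m : 'X_{1..n}) : {ffun 'I_n -> int} := [ffun i => (m i)%:Z].
have dg_inj : injective dg.
  by move=> m1 m2 /ffunP e; apply/mnmP => i; have := e i; rewrite !ffunE => -[].
have [p wp] := quot_proj_surj w; rewrite -/(edge_proj p) in wp.
pose f a := edge_proj (\sum_(m <- msupp p | dg m == a) p@_m *: 'X_[m]).
exists (map dg (msupp p)), f; split=> [a|].
  rewrite /f; exists (\sum_(m <- msupp p | dg m == a) p@_m *: 'X_[m]) => //.
  elim/big_ind: _ => [m|g1 g2 h1 h2 m|m1 /eqP <- m].
  - by rewrite msupp0.
  - by move=> /msuppD_le; rewrite mem_cat => /orP[/h1|/h2].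
  by move=> /msuppZ_le; rewrite msuppX inE => /eqP -> i; rewrite ffunE.
rewrite wp {1}[p]mpolyE edge_proj_sum [RHS]big_map; apply: eq_big_seq => m mp.
rewrite /f; congr edge_proj; rewrite big_mkcond (bigD1_seq m) //= eqxx.
rewrite big1 ?addr0 // => m1 /negPf m1m.
by rewrite (inj_eq dg_inj) m1m.
Qed.

Fact edge_mon_closed (f : S) m :
  f \in edge_ideal -> f@_m *: 'X_[m] \in edge_ideal.
Proof.
have monE e : exists m0, edge_mon e = 'X_[m0].
  rewrite /edge_mon; elim/big_ind: _ => [|x y [m1 ->] [m2 ->]|i _].
  - by exists 0%MM; rewrite mpolyX0.
  - by exists (m1 + m2)%MM; rewrite mpolyXD.
  by exists U_(i)%MM.
move=> /edge_idealP[c ->]; apply/edge_idealP.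
have P (e : {set T}) : exists b, (c e * edge_mon e)@_m *: 'X_[m] = b * edge_mon e.
  have [m0 ->] := monE e; rewrite mulrC.
  have [le_m0m|nle] := boolP (m0 <= m)%MM.
    exists (('X_[m0] * c e)@_m *: 'X_[(m - m0)]).
    by rewrite -scalerAl -mpolyXD submK.
  exists 0; rewrite mul0r; apply/eqP; rewrite scaler_eq0; apply/orP; left.
  rewrite mulrC; apply/eqP/memN_msupp_eq0; apply: contra nle.
  rewrite (perm_mem (msuppMX _ _)) => /mapP[m1 _ ->].
  exact: lem_addr.
have [b bE] := choice P.
exists b; rewrite raddf_sum scaler_suml.
by apply: eq_bigr => e _; exact: bE.
Qed.

Fact edge_component_indep (A : seq {ffun 'I_n -> int}) f :
  uniq A -> (forall a, edge_component a (f a)) -> \sum_(a <- A) f a = 0 ->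
  forall a, a \in A -> f a = 0.
Proof.
move=> uA fa sum0 a aA.
have /all_sig2[g ga fE] := fun b => cid2 (fa b); rewrite fE.
have sI : \sum_(a <- A) g a \in edge_ideal.
  apply/edge_proj_eq0; rewrite edge_proj_sum -[RHS]sum0.
  by apply: eq_bigr => b _.
apply/edge_proj_eq0; rewrite [g a]mpolyE big_seq.
apply: rpred_sum => m mga.
suff -> : (g a)@_m = (\sum_(a <- A) g a)@_m by apply: edge_mon_closed.
rewrite raddf_sum (bigD1_seq a) //= big1 ?addr0 // => b ba.
apply/memN_msupp_eq0; apply: contra ba => mgb; apply/eqP/ffunP => i.
by rewrite -(ga _ _ mgb) (ga _ _ mga).
Qed.

(* The standard grading: [component a] is the image of the span of x^a. *)
Definition edge_grading : multigrading edge_quot :=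
  Multigrading edge_component0 edge_componentD edge_componentZ
    edge_componentX edge_component_span edge_component_indep.

End EdgeIdeal.

Arguments edge_quot K {T n} v D.
Arguments edge_grading K {T n} v D.

(* Main.v *)
Require Import Defs.
From HB Require Import structures.
From mathcomp Require Import all_boot all_order all_algebra.
From mathcomp Require Import boolp mpoly.
From mathcomp Require Import ring zify.

(* Let [N] be the set of (supports of) generators of [I = I(c_d(C))]. If [x] is
   simplicial, [N] is the union of the generators [NJ] of [I(c_d(C \ x))] and of
   the sets [x |: F], [F] in the generators [NL] of [I(c_(d-1)(C / x))], and
   every member of [NJ] contains one of [NL]. This recursion produces a number
   [p] (the projective dimension of [S/I]), and [n - p] separates the two depths.

   - Stanley depth is at least [n - p]: the squarefree monomials outside [I] are
     partitioned into intervals [[A, B]] with [n - p <= #|B|], by joining a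
     partition for [NJ] to one for [NL] shifted by [x].
   - Depth is at most [n - p]: a nonzero class of degree [i] in the Koszul
     cohomology of [M] bounds the length of regular sequences by [i], and the
     recursion builds such a class of degree [n - p], as a cocycle of the simplex
     supported on [N]. Extending a cocycle from [NJ] to [N] requires that it
     bounds in [NL], which is the linearity of the resolution. *)

Set Implicit Arguments.
Unset Strict Implicit.
Unset Printing Implicit Defensive.

Import GRing.Theory.
Local Open Scope ring_scope.

(** * Koszul complexes and regular sequences *)

Section Exterior.
Variables (R : comNzRingType) (M : lmodType R) (n : nat).
Local Notation cochain := {ffun {set 'I_n} -> M}.
Implicit Types (j k : 'I_n) (F : {set 'I_n}) (c : cochain).

(** The factor that an element [k] contributes to [pos_sign j]. The latter is the sign of moving the
    basis vector [e_j] to its place in [e_F]. *)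
Definition swap_sign k j : R := (-1) ^+ (k < j)%N.

Definition pos_sign j F : R := (-1) ^+ #|[set i in F | (i < j)%N]|.

(** A cochain stands for an element of the exterior algebra on [n] vectors with coefficients in [M],
    with [c F] the coefficient of [e_F]. Here [wedge j] is left multiplication by [e_j] and
    [contract j] is contraction by the dual vector. *)
Definition wedge j c : cochain :=
  [ffun F : {set 'I_n} => if j \in F then pos_sign j F *: c (F :\ j) else 0].

Definition contract j c : cochain :=
  [ffun F : {set 'I_n} => if j \in F then 0 else pos_sign j F *: c (j |: F)].

Lemma pos_signU j k F : k \notin F ->
  pos_sign j (k |: F) = swap_sign k j * pos_sign j F.
Proof.
move=> kF; rewrite /pos_sign /swap_sign -exprD; congr (_ ^+ _).
case kj: (k < j)%N.
  rewrite (_ : [set i in k |: F | _] = k |: [set i in F | (i < j)%N]).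
    by rewrite cardsU1 inE (negPf kF).
  by apply/setP => i; rewrite !inE; case: eqP => // ->; rewrite kj.
congr #|pred_of_set _|; apply/setP => i; rewrite !inE.
by case: eqP => // ->; rewrite kj (negPf kF).
Qed.

Lemma pos_signD1 j k F : k \in F ->
  pos_sign j F = swap_sign k j * pos_sign j (F :\ k).
Proof. by move=> kF; rewrite -{1}(setD1K kF) pos_signU // !inE eqxx. Qed.

Lemma swap_sign_id j : swap_sign j j = 1.
Proof. by rewrite /swap_sign ltnn. Qed.

Lemma swap_sign_anti j k : j != k -> swap_sign j k = - swap_sign k j.
Proof.
rewrite -(inj_eq val_inj) /swap_sign /=.
by case: (ltngtP j k) => // _ _; rewrite /= expr0 expr1 ?opprK.
Qed.

Lemma swap_signM j k : swap_sign j k * swap_sign j k = 1.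
Proof. by rewrite /swap_sign; case: (_ < _)%N; rewrite ?expr1 ?mulrNN mulr1. Qed.

Lemma pos_signM j F : pos_sign j F * pos_sign j F = 1.
Proof. by rewrite -expr2 sqrr_sign. Qed.

Fact wedge_is_linear j : linear (wedge j).
Proof.
move=> a c1 c2; apply/ffunP => F; rewrite /wedge /contract !ffunE.
case: ifP => _; last by rewrite scaler0 addr0.
by rewrite scalerDr !scalerA mulrC.
Qed.
HB.instance Definition _ j :=
  GRing.isLinear.Build R cochain cochain _ (wedge j) (wedge_is_linear j).

Fact contract_is_linear j : linear (contract j).
Proof.
move=> a c1 c2; apply/ffunP => F; rewrite /wedge /contract !ffunE.
case: ifP => _; first by rewrite scaler0 addr0.
by rewrite scalerDr !scalerA mulrC.
Qed.
HB.instance Definition _ j :=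
  GRing.isLinear.Build R cochain cochain _ (contract j) (contract_is_linear j).

Lemma wedge_anti j k c : wedge j (wedge k c) = - wedge k (wedge j c).
Proof.
apply/eqP; rewrite -addr_eq0; apply/eqP/ffunP => F; rewrite !ffunE.
have [->|jk] := eqVneq j k.
  by case: ifP => kF; rewrite ?addr0 // !inE eqxx scaler0 addr0.
rewrite !inE jk eq_sym jk /=.
case jF: (j \in F); case kF: (k \in F); rewrite ?scaler0 ?addr0 //=.
rewrite !scalerA (pos_signD1 j kF) (pos_signD1 k jF) (swap_sign_anti jk).
rewrite !setDDl setUC -scalerDl; set x := _ + _.
by rewrite (_ : x = 0) ?scale0r // /x; ring.
Qed.

Lemma wedge_id j c : wedge j (wedge j c) = 0.
Proof.
apply/ffunP => F; rewrite /wedge /contract !ffunE.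
by case: ifP => jF; rewrite // !inE eqxx scaler0.
Qed.

Lemma contract_wedge j k c : j != k ->
  contract j (wedge k c) = - wedge k (contract j c).
Proof.
move=> jk; apply/eqP; rewrite -addr_eq0; apply/eqP/ffunP => F; rewrite !ffunE.
rewrite !inE jk eq_sym (negPf jk) /=.
case jF: (j \in F); case kF: (k \in F); rewrite ?scaler0 ?addr0 //=.
have -> : (j |: F) :\ k = j |: (F :\ k).
  by apply/setP => i; rewrite !inE; case: eqP => // ->; rewrite eq_sym (negPf jk).
rewrite !scalerA (pos_signD1 j kF) pos_signU ?jF // (swap_sign_anti jk) -scalerDl.
set a := pos_sign j _; set b := pos_sign k F; set s := swap_sign k j.
have -> : s * a * (- s * b) + b * a = (1 - s * s) * (a * b) by ring.
by rewrite /s swap_signM subrr mul0r scale0r.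
Qed.

Lemma contract_wedge_id j c : contract j (wedge j c) + wedge j (contract j c) = c.
Proof.
apply/ffunP => F; rewrite /wedge /contract !ffunE !inE eqxx /=.
case jF: (j \in F); rewrite ?add0r ?addr0.
  by rewrite setD1K // scalerA (pos_signD1 j jF) swap_sign_id mul1r pos_signM scale1r.
by rewrite setU1K ?jF // scalerA pos_signU ?jF // swap_sign_id mul1r pos_signM scale1r.
Qed.


Variable x : 'I_n -> R.

(** Left multiplication by the vector with coordinates [x]. Variables give the Koszul cochain
    complex and a 0-1 vector gives the coboundary of a simplex, so both are treated at once. *)
Definition koszul c : cochain := \sum_j x j *: wedge j c.

Fact koszul_is_linear : linear koszul.
Proof.
move=> a c1 c2; rewrite /koszul scaler_sumr -big_split /=.
by apply: eq_bigr => j _; rewrite linearP scalerDr !scalerA mulrC.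
Qed.
HB.instance Definition _ :=
  GRing.isLinear.Build R cochain cochain _ koszul koszul_is_linear.

(** Only the index [j] survives, since [contract j] anticommutes with every other [wedge k]. Thus
    contraction is a homotopy from multiplication by [x j] to zero. *)
Lemma contract_koszul j c :
  contract j (koszul c) + koszul (contract j c) = x j *: c.
Proof.
rewrite /koszul linear_sum -big_split /= (bigD1 j) //= big1 => [|k kj].
  by rewrite addr0 linearZ /= -scalerDr contract_wedge_id.
by rewrite linearZ /= contract_wedge 1?eq_sym // scalerN addNr.
Qed.

Lemma wedge_koszul k c : wedge k (koszul c) = - koszul (wedge k c).
Proof.
rewrite /koszul linear_sum -sumrN; apply: eq_bigr => j _.
by rewrite linearZ /= wedge_anti scalerN.
Qed.

Lemma contractE j c F : j \notin F -> contract j c F = pos_sign j F *: c (j |: F).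
Proof. by move=> /negPf jF; rewrite /contract ffunE jF. Qed.

(* [koszul \o koszul] commutes with every contraction and vanishes at [set0]. *)
Lemma koszul_koszul c : koszul (koszul c) = 0.
Proof.
have comm j b : contract j (koszul (koszul b)) = koszul (koszul (contract j b)).
  have cE b' : contract j (koszul b') = x j *: b' - koszul (contract j b').
    by rewrite -contract_koszul addrK.
  by rewrite !cE linearB linearZ /= subKr.
apply/ffunP => F; rewrite [RHS]ffunE.
move: {2}#|F| (erefl #|F|) => m; elim: m c F => [|m IHm] c F.
  move=> /cards0_eq ->; rewrite sum_ffunE big1 // => j _.
  by rewrite !ffunE inE scaler0.
move=> Fm; have /card_gt0P[j jF] : (0 < #|F|)%N by rewrite Fm.
have jF' : j \notin F :\ j by rewrite !inE eqxx.
have := IHm (contract j c) (F :\ j); rewrite -comm contractE // setD1K //.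
move=> /(_ _)/(congr1 ( *:%R (pos_sign j (F :\ j)))).
rewrite scalerA pos_signM scale1r scaler0; apply.
by apply/eqP; rewrite -(eqn_add2l 1) -[X in _ == X]Fm (cardsD1 j F) jF.
Qed.

Lemma contract_sum_koszul (h : 'I_n -> R) c :
  \sum_j h j *: contract j (koszul c) + koszul (\sum_j h j *: contract j c) =
  (\sum_j h j * x j) *: c.
Proof.
rewrite linear_sum -big_split /= scaler_suml; apply: eq_bigr => j _.
by rewrite linearZ /= -scalerDr contract_koszul scalerA.
Qed.

End Exterior.

(** * Koszul cohomology modulo a regular sequence *)

Section RegularSequences.
Variables (K : fieldType) (n : nat) (M : lmodType {mpoly K[n]}).
Local Notation S := {mpoly K[n]}.
Implicit Types (fs : seq S) (w : M) (z : {ffun {set 'I_n} -> M}).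

(** Coefficients indexed by [nat] survive a change of length of [fs] without casts between
    ordinals. *)
Lemma ideal_mulP fs w : ideal_mul fs w <->
  exists y : nat -> M, w = \sum_(j < size fs) fs`_j *: y j.
Proof.
split=> [[y ->]|[y ->]]; last by exists (fun j => y j).
exists (fun j => if insub j is Some i then y i else 0).
by apply: eq_bigr => j _; rewrite valK.
Qed.

Lemma ideal_mulB fs w1 w2 :
  ideal_mul fs w1 -> ideal_mul fs w2 -> ideal_mul fs (w1 - w2).
Proof.
move=> [y1 ->] [y2 ->]; exists (fun j => y1 j - y2 j).
by rewrite -sumrB; apply: eq_bigr => j _; rewrite scalerBr.
Qed.

Lemma ideal_mul0 fs : ideal_mul fs (0 : M).
Proof. by exists (fun=> 0); rewrite big1 // => j _; rewrite scaler0. Qed.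

Lemma ideal_mulD fs w1 w2 :
  ideal_mul fs w1 -> ideal_mul fs w2 -> ideal_mul fs (w1 + w2).
Proof.
move=> h1 h2; rewrite -[w2]opprK; apply: ideal_mulB => //.
by rewrite -[- w2]sub0r; apply: ideal_mulB => //; apply: ideal_mul0.
Qed.

Lemma ideal_mulZ fs f w : ideal_mul fs w -> ideal_mul fs (f *: w).
Proof.
move=> [y ->]; exists (fun j => f *: y j).
by rewrite scaler_sumr; apply: eq_bigr => j _; rewrite !scalerA mulrC.
Qed.

Lemma ideal_mul_sum fs (I : Type) (r : seq I) (P : pred I) (w : I -> M) :
  (forall i, P i -> ideal_mul fs (w i)) -> ideal_mul fs (\sum_(i <- r | P i) w i).
Proof.
move=> h; elim/big_ind: _ => //; [exact: ideal_mul0|exact: ideal_mulD].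
Qed.

Lemma ideal_mul_rcons fs f w :
  ideal_mul (rcons fs f) w <-> exists u, ideal_mul fs (w - f *: u).
Proof.
split=> [/ideal_mulP[y ->]|[u /ideal_mulP[y wE]]].
  exists (y (size fs)); rewrite size_rcons big_ord_recr /= nth_rcons ltnn eqxx addrK.
  apply/ideal_mulP; exists y; apply: eq_bigr => j _.
  by rewrite nth_rcons ltn_ord.
apply/ideal_mulP; exists (fun j => if (j < size fs)%N then y j else u).
rewrite size_rcons big_ord_recr /= nth_rcons ltnn eqxx.
apply/eqP; rewrite -subr_eq; apply/eqP; rewrite wE; apply: eq_bigr => j _.
by rewrite nth_rcons ltn_ord.
Qed.

(** Congruence to zero modulo (fs)M; it replaces cochains with values in the quotient module. *)
Definition ideal_mul_cochain fs z := forall F, ideal_mul fs (z F).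

Lemma ideal_mul_wedge fs j z :
  ideal_mul_cochain fs z -> ideal_mul_cochain fs (wedge j z).
Proof.
move=> h F; rewrite /wedge ffunE; case: ifP => _; last exact: ideal_mul0.
exact: ideal_mulZ.
Qed.

Lemma ideal_mul_contract fs j z :
  ideal_mul_cochain fs z -> ideal_mul_cochain fs (contract j z).
Proof.
move=> h F; rewrite /contract ffunE; case: ifP => _; first exact: ideal_mul0.
exact: ideal_mulZ.
Qed.

Lemma ideal_mul_cochain_comb fs (I : Type) (r : seq I) (a : I -> S)
    (z : I -> {ffun {set 'I_n} -> M}) :
  (forall i, ideal_mul_cochain fs (z i)) ->
  ideal_mul_cochain fs (\sum_(i <- r) a i *: z i).
Proof.
move=> h F; rewrite sum_ffunE; apply: ideal_mul_sum => i _.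
by rewrite ffunE; apply: ideal_mulZ; apply: h.
Qed.

Local Notation X := (fun j : 'I_n => 'X_j : S).

(* Contracting along [h], where [f = \sum_j h j * 'X_j], turns a class of the
   Koszul cohomology of M/(fs)M into one of M/(fs, f)M in one degree less. *)
Lemma koszul_class_regular z i fs :
  (forall F, z F != 0 -> #|F| = i) -> koszul X z = 0 ->
  (forall y, z <> koszul X y) ->
  (forall f, f \in fs -> irrelevant_ideal f) -> regular_sequence M fs ->
  (size fs <= i)%N.
Proof.
move=> zi dz0 znb fs_irr [fs_reg _].
rewrite leqNgt; apply/negP => lt_i.
(* After [k] elements there remains a nonzero class of degree [i - k], written as [#|F| + k = i] to
   avoid truncated subtraction. At [k = i.+1] no degree is left, so [z'] is zero and bounds, a
   contradiction. *)
suff H k : (k <= size fs)%N -> exists z' : {ffun {set 'I_n} -> M},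
    [/\ forall F, z' F != 0 -> (#|F| + k = i)%N,
        ideal_mul_cochain (take k fs) (koszul X z')
      & forall y, ~ ideal_mul_cochain (take k fs) (z' - koszul X y)].
  have [z' [z'i _ /(_ 0)[]]] := H _ lt_i => F.
  rewrite linear0 subr0.
  have [->|/z'i e] := eqVneq (z' F) 0; first exact: ideal_mul0.
  by move: e; rewrite addnS => e; have := leq_addl #|F| i; rewrite -ltnS e ltnn.
elim: k => [_|k IHk lt_k].
  exists z; split=> [F|F|y h]; rewrite ?take0 ?addn0.
  - exact: zi.
  - by rewrite dz0 ffunE; apply: ideal_mul0.
  - apply: (znb y); apply/eqP; rewrite -subr_eq0; apply/eqP/ffunP => F.
    by have := h F; rewrite take0 => -[u]; rewrite big_ord0 => ->; rewrite ffunE.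
have [z' [z'i dz' z'nb]] := IHk (ltnW lt_k).
have [h fE] : irrelevant_ideal fs`_k by apply: fs_irr; apply: mem_nth.
have tE : take k.+1 fs = rcons (take k fs) fs`_k by rewrite -take_nth.
pose w := \sum_j h j *: contract j z'.
have dw : ideal_mul_cochain (take k fs) (koszul X w - fs`_k *: z').
  rewrite fE -contract_sum_koszul -/w opprD addrCA subrr addr0 -sumrN.
  under eq_bigr do rewrite -scaleNr.
  by apply: ideal_mul_cochain_comb => j; apply: ideal_mul_contract.
exists w; split=> [F|F|y hy].
- rewrite /w sum_ffunE => nz; have [j] : exists j, contract j z' F != 0.
    apply/existsP; apply: contraNT nz => /existsPn all0.
    by rewrite big1 // => j _; rewrite ffunE (eqP (negPn (all0 j))) scaler0.
  rewrite /contract ffunE; case: ifPn => jF; rewrite ?eqxx // => nz1.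
  rewrite -(z'i (j |: F)) ?cardsU1 ?jF ?addnS //.
  by apply: contraNneq nz1 => ->; rewrite scaler0.
- rewrite tE; apply/ideal_mul_rcons; exists (z' F).
  by have := dw F; rewrite !ffunE.
(* Let f be the element of index [k]. If [w] bounds modulo [take k.+1 fs], then [w] is
   [koszul X y + f *: U] modulo [take k fs]. Applying [koszul X] puts [f *: (z' - koszul X U)] in
   the smaller submodule, and regularity makes [z'] a coboundary there. *)
have /choice[u hu] : forall F, exists u, ideal_mul (take k fs)
    ((w - koszul X y) F - fs`_k *: u).
  by move=> F; apply/ideal_mul_rcons; rewrite -tE; apply: hy.
pose U : {ffun {set 'I_n} -> M} := [ffun F => u F].
have hU : ideal_mul_cochain (take k fs) (w - koszul X y - fs`_k *: U).
  by move=> F; have := hu F; rewrite !ffunE.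
apply: (z'nb U) => F; apply: fs_reg => //.
have dU : ideal_mul_cochain (take k fs) (koszul X (w - koszul X y - fs`_k *: U)).
  by apply: ideal_mul_cochain_comb => j; apply: ideal_mul_wedge.
have -> : fs`_k *: (z' - koszul X U) F = (fs`_k *: (z' - koszul X U)) F.
  by rewrite [RHS]ffunE.
have -> : fs`_k *: (z' - koszul X U) = koszul X (w - koszul X y - fs`_k *: U)
    - (koszul X w - fs`_k *: z').
  have kB a b : koszul X (a - b) = koszul X a - koszul X b by rewrite linearB.
  by rewrite !kB linearZ /= koszul_koszul subr0 scalerBr opprB [RHS]addrC addrA subrK.
by have := ideal_mulB (dU F) (dw F); rewrite !(ffunE _ F).
Qed.
End RegularSequences.

(** * Cocycles supported on a linear family *)

Lemma subset_setU1_notin (T : finType) (x : T) (A B : {set T}) :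
  x \notin A -> (A \subset x |: B) = (A \subset B).
Proof.
by move=> xA; rewrite -subDset (setDidPl _) // disjoint_sym disjoints1.
Qed.

Section CochainSupport.
Variables (R : comNzRingType) (M : lmodType R) (n : nat).
Implicit Types (j : 'I_n) (F : {set 'I_n}) (c : {ffun {set 'I_n} -> M}).

Lemma wedge_neq0 j c F : wedge j c F != 0 -> j \in F /\ c (F :\ j) != 0.
Proof.
rewrite /wedge ffunE; case: ifP; rewrite ?eqxx // => _ nz; split=> //.
by apply: contraNneq nz => ->; rewrite scaler0.
Qed.

Lemma contract_neq0 j c F : contract j c F != 0 -> j \notin F /\ c (j |: F) != 0.
Proof.
rewrite /contract ffunE; case: ifP; rewrite ?eqxx // => _ nz; split=> //.
by apply: contraNneq nz => ->; rewrite scaler0.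
Qed.

Lemma ffun_eq0P c : (forall F, c F != 0 -> False) -> c = 0.
Proof.
by move=> h; apply/ffunP => F; rewrite ffunE; apply/eqP/negPn/negP => /h.
Qed.

End CochainSupport.

(* [p] is 1 + the projective dimension of the ideal generated by [N]; it is 0
   for the zero ideal and 1 for the unit ideal. *)
Inductive linear_family (n : nat) :
    {set 'I_n} -> nat -> {set {set 'I_n}} -> nat -> Prop :=
  | LF_empty V d : linear_family V d set0 0
  | LF_unit V : linear_family V 0 [set set0] 1
  | LF_step (V : {set 'I_n}) d v (NJ NL : {set {set 'I_n}}) pJ pL : v \in V ->
      linear_family (V :\ v) d.+1 NJ pJ -> linear_family (V :\ v) d NL pL ->
      (0 < pL)%N -> (forall G, G \in NJ -> exists2 F, F \in NL & F \subset G) ->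
      linear_family V d.+1 (NJ :|: [set v |: F | F in NL]) (maxn pJ.+1 pL).

Lemma linear_family_mem n (V : {set 'I_n}) d N p G :
  linear_family V d N p -> G \in N -> G \subset V /\ #|G| = d.
Proof.
move=> fam; elim: fam G => {V d N p} [V d|V|V d v NJ NL pJ pL vV _ IHJ _ IHL _ _] G.
- by rewrite inE.
- by rewrite inE => /eqP ->; rewrite sub0set cards0.
rewrite inE => /orP[/IHJ[/subsetD1P[]]//|/imsetP[F /IHL[/subsetD1P[FV vF] <-] ->]].
by rewrite cardsU1 vF subUset sub1set vV.
Qed.

Lemma linear_family_gt0 n (V : {set 'I_n}) d N p :
  linear_family V d N p -> N != set0 -> (0 < p)%N.
Proof. by case=> [V' d'|//|*]; [rewrite eqxx | rewrite leq_max]. Qed.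

(** * Coboundaries of simplices *)

Section SimplexCochains.
Variables (K : fieldType) (n : nat).
Local Notation cochain := {ffun {set 'I_n} -> K^o}.
Implicit Types (V U B F G : {set 'I_n}) (N : {set {set 'I_n}}) (b c : cochain).

Definition delta V c : cochain := koszul (fun j => (j \in V)%:R) c.

Lemma deltaB V c1 c2 : delta V (c1 - c2) = delta V c1 - delta V c2.
Proof. by rewrite /delta linearB. Qed.

Lemma deltaN V c : delta V (- c) = - delta V c.
Proof. by rewrite /delta linearN. Qed.

Lemma delta_delta V c : delta V (delta V c) = 0.
Proof. exact: koszul_koszul. Qed.

Lemma wedge_delta k V c : wedge k (delta V c) = - delta V (wedge k c).
Proof. exact: wedge_koszul. Qed.

(** The simplex on [V] is a cone with apex [j], so contraction at [j] fills every cocycle. *)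
Lemma contract_delta j V c : j \in V ->
  contract j (delta V c) + delta V (contract j c) = c.
Proof. by move=> jV; rewrite contract_koszul jV scale1r. Qed.

Lemma contract_delta_notin j V c : j \notin V ->
  contract j (delta V c) = - delta V (contract j c).
Proof.
move=> /negPf jV; apply/eqP; rewrite -addr_eq0 contract_koszul jV.
by rewrite scale0r.
Qed.

Lemma deltaD1 v V c : v \in V -> delta V c = delta (V :\ v) c + wedge v c.
Proof.
move=> vV; rewrite /delta /koszul (bigD1 v) //= vV scale1r.
rewrite [X in _ = X + _](bigD1 v) //= !inE eqxx scale0r add0r addrC.
by congr (_ + _); apply: eq_bigr => j jv; rewrite !inE jv.
Qed.

(* [U] is the complement of the vertices carrying the multidegree: a cochain
   on the faces of [V :\: U] is encoded by its product with the basis vectors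
   indexed by [U]. *)
Definition supported_on U V N c := forall B, c B != 0 ->
  [/\ U \subset B, B \subset V & B :\: U \in N].

(** When the members of [N] have [d] elements, these are the faces obtained from those of
    [supported_on] by adding one vertex: the ideal one degree above its generators. *)
Definition supported_above d U V N c := forall B, c B != 0 ->
  [/\ U \subset B, B \subset V, #|B :\: U| = d.+1
    & exists2 F, F \in N & F \subset B :\: U].

Lemma supported_on_wedge v U V N N' c :
  v \in V -> U \subset V :\ v -> supported_on U (V :\ v) N' c ->
  (forall F, F \in N' -> v |: F \in N) -> supported_on U V N (wedge v c).
Proof.
move=> vV /subsetD1P[UV vU] sc NN' B /wedge_neq0[vB /sc[UB BV BN]]; split.
- exact: subset_trans UB (subsetDl _ _).
- by rewrite -(setD1K vB) subUset sub1set vV (subset_trans BV) ?subsetDl.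
have -> : B :\: U = v |: ((B :\ v) :\: U); last exact: NN'.
by apply/setP => i; rewrite !inE; case: eqP => // ->; rewrite vB vU.
Qed.

(* The ideal generated by [N] has a linear resolution: the strand next to the
   linear one is exact. *)
Lemma linear_family_exact V d N p U c :
  linear_family V d N p -> U \subset V ->
  supported_above d U V N c -> delta V c = 0 ->
  exists2 b, supported_on U V N b & delta V b = c.
Proof.
move=> fam; elim: fam U c => {V d N p}
  [V d|V|V d v NJ NL pJ pL vV famJ IHJ famL IHL _ JL] U c UV sc dc0.
- exists 0; first by move=> B; rewrite ffunE eqxx.
  rewrite /delta linear0; apply/esym/ffun_eq0P => B /sc[_ _ _ [F]].
  by rewrite inE.
(* For the unit family, [B :\: U] is a single vertex. Contracting at any [j] outside [U] leaves only
   [B :\: U = set0], the one generator. *)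
- have [/eqP|/set0Pn[j]] := boolP (V :\: U == set0).
    move=> /eqP; rewrite setD_eq0 => VU; exists 0.
      by move=> B; rewrite ffunE eqxx.
    rewrite /delta linear0; apply/esym/ffun_eq0P => B /sc[_ BV].
    have /eqP -> : B :\: U == set0 by rewrite setD_eq0 (subset_trans BV).
    by rewrite cards0.
  rewrite inE => /andP[jU jV]; exists (contract j c).
    move=> B /contract_neq0[jB /sc[]].
    rewrite subset_setU1_notin // => UB; rewrite subUset sub1set => /andP[_ BV].
    have -> : (j |: B) :\: U = j |: (B :\: U).
      by apply/setP => i; rewrite !inE; case: eqP => // ->; rewrite jU.
    rewrite cardsU1 !inE jU (negPf jB) => -[/eqP]; rewrite cards_eq0 => BU _.
    by split.
  by have := contract_delta c jV; rewrite dc0 linear0 add0r.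
have JV G : G \in NJ -> v \notin G.
  by move=> /(linear_family_mem famJ)[/subsetD1P[]].
(* If [v] is in [U], all faces of [c] contain [v], so [c] is [v] wedged with a cochain. No [B :\: U]
   contains [v], so only generators from [NJ] matter, and [IHJ] applies with [v] removed from
   [U]. *)
have [vU|vU] := boolP (v \in U).
  have wc0 : wedge v c = 0.
    apply: ffun_eq0P => B /wedge_neq0[vB /sc[/subsetP/(_ _ vU)]].
    by rewrite !inE eqxx.
  have cE : c = wedge v (contract v c).
    by rewrite -{1}(contract_wedge_id v c) wc0 linear0 add0r.
  have [] := IHJ (U :\ v) (contract v c); first exact: setSD.
  - move=> B /contract_neq0[vB /sc[UB]].
    rewrite subUset sub1set => /andP[_ BV].
    have -> : (v |: B) :\: U = B :\: (U :\ v).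
      by apply/setP => i; rewrite !inE; case: eqP => // ->; rewrite vU (negPf vB).
    move=> cB [F FN FB]; split=> //.
    + by rewrite -(setU1K vB) setSD.
    + by rewrite subsetD1 BV.
    + exists F => //; case/setUP: FN => // /imsetP[F' _ FE]; move/subsetP: FB.
      by move=> /(_ v); rewrite FE !inE eqxx (negPf vB) => /(_ isT).
  - have := contract_delta_notin c (negbT (setD11 v V)).
    move: dc0; rewrite (deltaD1 _ vV) wc0 addr0 => ->.
    by rewrite linear0 => /eqP; rewrite eq_sym oppr_eq0 => /eqP.
  move=> b sb db; exists (- wedge v b).
    move=> B; rewrite ffunE oppr_eq0 => /wedge_neq0[vB /sb[UB BV BN]]; split.
    + by rewrite -(setD1K vU) -(setD1K vB) setUS.
    + by rewrite -(setD1K vB) subUset sub1set vV (subset_trans BV) ?subsetDl.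
    + rewrite inE; apply/orP; left; congr (_ \in NJ): BN.
      by apply/setP => i; rewrite !inE; case: eqP => // ->; rewrite vU.
  by rewrite deltaN -wedge_delta (deltaD1 _ vV) db linearD /= wedge_id addr0.
(* If [v] is not in [U], write [c = c0 + wedge v c1] with [c0 = delta (V :\ v) c1] free of [v].
   [IHJ] fills [c0] by [b0]; then [c1 - b0] is a cocycle over [NL], filled by [b1], and
   [b0 - wedge v b1] fills [c]. *)
have UV' : U \subset V :\ v by rewrite subsetD1 UV.
have dc1 : delta V (contract v c) = c.
  by have := contract_delta c vV; rewrite dc0 linear0 add0r.
set c1 := contract v c in dc1 *.
have c0E : delta (V :\ v) c1 = contract v (wedge v c).
  rewrite -[RHS](addrK (wedge v c1)) contract_wedge_id -[X in X - _]dc1.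
  by rewrite (deltaD1 _ vV) addrK.
have [|||b0 sb0 db0] := IHJ U (delta (V :\ v) c1) => //.
- rewrite c0E => B /contract_neq0[vB /wedge_neq0[_]]; rewrite setU1K //.
  move=> /sc[UB BV cB [F FN FB]]; split=> //; first by rewrite subsetD1 BV.
  exists F => //; case/setUP: FN => // /imsetP[F' _ FE]; move/subsetP: FB.
  by move=> /(_ v); rewrite FE !inE eqxx (negPf vB) andbF => /(_ isT).
- exact: delta_delta.
have [|||b1 sb1 db1] := IHL U (c1 - b0) => //.
- move=> B nz; have [] : c1 B != 0 \/ b0 B != 0.
  + apply/orP; apply: contraNT nz; rewrite negb_or !negbK.
    by rewrite !ffunE => /andP[/eqP -> /eqP ->]; rewrite subr0.
  + move=> /contract_neq0[vB /sc[]]; rewrite subset_setU1_notin // => UB.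
    rewrite subUset sub1set => /andP[_ BV].
    have -> : (v |: B) :\: U = v |: (B :\: U).
      by apply/setP => i; rewrite !inE; case: eqP => // ->; rewrite vU.
    rewrite cardsU1 !inE vU (negPf vB) => -[cB] [F FN FB].
    split=> //; first by rewrite subsetD1 BV.
    case/setUP: FN FB => [FJ FB|/imsetP[F' F'L -> FB]].
      have [F' F'L F'F] := JL _ FJ; exists F' => //.
      apply: subset_trans F'F _.
      by rewrite subset_setU1_notin ?JV // in FB.
    have [/subsetD1P[_ vF'] _] := linear_family_mem famL F'L.
    exists F' => //; rewrite -(subset_setU1_notin _ vF').
    by apply: subset_trans FB; apply: subsetUr.
  + move=> /sb0[UB BV BN]; split=> //; last exact: JL.
    by have [_ ->] := linear_family_mem famJ BN.
- by rewrite deltaB db0 subrr.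
exists (b0 - wedge v b1).
  move=> B nz; have [] : b0 B != 0 \/ wedge v b1 B != 0.
  - apply/orP; apply: contraNT nz; rewrite negb_or !negbK.
    by move=> /andP[/eqP e1 /eqP e2]; rewrite ffunE e1 ffunE e2 subr0.
  - move=> /sb0[UB BV BN]; split=> //; last by rewrite inE BN.
    by apply: subset_trans BV _; apply: subsetDl.
  - move: B {nz}; apply: (supported_on_wedge vV UV' sb1) => F FL.
    by rewrite inE imset_f ?orbT.
have -> : delta V (b0 - wedge v b1) = delta (V :\ v) c1 + wedge v c1.
  rewrite deltaB -[- delta _ _]wedge_delta !(deltaD1 _ vV) db0 db1.
  rewrite linearD linearB /= wedge_id addr0 -addrA.
  by rewrite [wedge v b0 + _]addrC subrK.
by rewrite -(deltaD1 _ vV).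
Qed.

(** The last equation fixes the degree: the faces of [c] have [d + #|U|] elements. Being nonzero is
    all that is needed, since the ideal has nothing in degrees below [d] that could bound [c]. *)
Lemma linear_family_cocycle V d N p :
  linear_family V d N p -> (0 < p)%N ->
  exists U c, [/\ U \subset V, c != 0, supported_on U V N c, delta V c = 0
    & (#|V| + 1 = p + d + #|U|)%N].
Proof.
elim=> {V d N p} [//|V _|V d v NJ NL pJ pL vV famJ IHJ famL IHL pL_gt0 JL _].
  exists V, [ffun B => (B == V)%:R]; split=> //.
  - by apply/eqP => /ffunP/(_ V)/eqP; rewrite !ffunE eqxx oner_eq0.
  - move=> B; rewrite ffunE; have [->|_] := eqVneq B V; last by rewrite eqxx.
    by rewrite setDv inE subxx.
  - apply: ffun_eq0P => B; rewrite sum_ffunE big1 ?eqxx // => j _.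
    rewrite !ffunE; case jV: (j \in V); last by rewrite scale0r.
    case: ifP => jB; last by rewrite scaler0.
    have [E|_] := eqVneq; last by rewrite !scaler0.
    by move: jV; rewrite -E !inE eqxx.
  - by rewrite addn0 addnC.
have vD : v \notin V :\ v by rewrite !inE eqxx.
have cV : #|V| = #|V :\ v|.+1 by rewrite (cardsD1 v V) vV.
(* The family attaining the maximum supplies the cocycle: one from [NL] is wedged with [v], one from
   [NJ] is extended by faces through [v]. *)
have [le|lt] := leqP pJ.+1 pL.
  have [U [c [UV nz sc dc cU]]] := IHL pL_gt0.
  exists U, (wedge v c); split.
  - exact: subset_trans UV (subsetDl _ _).
  - apply: contraNneq nz => wc0; rewrite -(contract_wedge_id v c) wc0 linear0.
    rewrite add0r (_ : contract v c = 0) ?linear0 //.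
    apply: ffun_eq0P => B /contract_neq0[_ /sc[_ /subsetP/(_ v)]].
    by rewrite !inE eqxx => /(_ isT).
  - by apply: (supported_on_wedge vV UV sc) => F FL; rewrite inE imset_f ?orbT.
  - apply/eqP; rewrite -[delta _ _]opprK -wedge_delta (deltaD1 _ vV) dc add0r.
    by rewrite wedge_id oppr0.
  - by rewrite cV; lia.
have pJ_gt0 : (0 < pJ)%N by lia.
have [U [c [UV nz sc dc cU]]] := IHJ pJ_gt0.
(* Each member of [NJ] lies above one of [NL], so [c] bounds some [b] there. Then
   [delta V b = c + wedge v b] is a cocycle that restricts to [c] away from [v]. *)
have [|b sb db] := linear_family_exact famL UV _ dc.
  move=> B /sc[UB BV BN]; split=> //; last exact: JL.
  by have [_ ->] := linear_family_mem famJ BN.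
exists U, (delta V b); rewrite delta_delta (deltaD1 _ vV) db; split=> //.
- exact: subset_trans UV (subsetDl _ _).
- apply: contraNneq nz => e; apply/eqP/ffun_eq0P => B cB.
  have [_ /subsetD1P[_ vB] _] := sc _ cB.
  move/ffunP: e => /(_ B); rewrite !ffunE (negPf vB) addr0 => e.
  by rewrite e eqxx in cB.
- move=> B nzB; have [] : c B != 0 \/ wedge v b B != 0.
  + apply/orP; apply: contraNT nzB; rewrite negb_or !negbK.
    by move=> /andP[/eqP e1 /eqP e2]; rewrite ffunE e1 e2 addr0.
  + move=> /sc[UB BV BN]; split=> //; last by rewrite inE BN.
    by apply: subset_trans BV _; apply: subsetDl.
  + move: B {nzB}; apply: (supported_on_wedge vV UV sb) => F FL.
    by rewrite inE imset_f ?orbT.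
- by rewrite cV; lia.
Qed.

End SimplexCochains.

(** * Chordal clutters *)

Section ChordalClutters.
Variables (T : finType).
Implicit Types (C D : clutter T) (x : T) (e : {set T}).

Lemma minor_trans C D D' : minor C D -> minor D D' -> minor C D'.
Proof.
move=> CD; elim=> // E x _ CE xE; [exact: minor_del|exact: minor_contr].
Qed.

Lemma chordal_minor C D : chordal C -> minor C D -> chordal D.
Proof. by move=> chC CD E DE; apply: chC; apply: minor_trans DE. Qed.

Lemma contraction_edge_card d C x e :
  (forall e, e \in edges C -> (d < #|e|)%N) -> e \in edges (contraction C x) ->
  (d <= #|e|)%N.
Proof.
move=> Cmin; rewrite inE => /minsetp/imsetP[e' e'C ->].
by have := Cmin _ e'C; rewrite (cardsD1 x e'); case: (x \in e') => //=; lia.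
Qed.

(** Removing [x] leaves at least [d] elements in every edge, so a set of size [d] that arises this
    way is automatically minimal. An edge avoiding [x] is too large to give [e]. *)
Lemma contraction_edge d C x e :
  (forall e, e \in edges C -> (d < #|e|)%N) -> #|e| = d -> x \notin e ->
  (e \in edges (contraction C x)) = (x |: e \in edges C).
Proof.
move=> Cmin ed xe; apply/idP/idP => [|eC].
  rewrite inE => /minsetp/imsetP[e' e'C eE].
  have := Cmin _ e'C; rewrite (cardsD1 x e') -eE ed.
  case xe': (x \in e') => /=; last by rewrite ltnn.
  by rewrite eE setD1K.
rewrite inE; apply/minsetP; split=> [|f /imsetP[e' e'C fE] fe].
  by apply/imsetP; exists (x |: e); rewrite ?setU1K.
apply/eqP; rewrite eqEcard fe ed fE /=.
by have := Cmin _ e'C; rewrite (cardsD1 x e'); case: (x \in e') => /=; lia.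
Qed.

Variables (n : nat) (v : 'I_n -> T).
Hypothesis v_inj : injective v.

Definition vertices D : {set 'I_n} := v @^-1: vset D.

Definition nonedges d D : {set {set 'I_n}} :=
  [set A : {set 'I_n} | v @: A \in compl_edges d D].

Lemma nonedgesP d D (A : {set 'I_n}) : reflect
  [/\ A \subset vertices D, #|A| = d & v @: A \notin edges D]
  (A \in nonedges d D).
Proof.
rewrite !inE card_imset // sub_imset_pre.
by apply: (iffP and3P) => -[? /eqP ? ?].
Qed.

Lemma vertices_delete D i : v @^-1: (vset D :\ v i) = vertices D :\ i.
Proof. by apply/setP => j; rewrite !inE (inj_eq v_inj). Qed.

Lemma imset_setU1 i (A : {set 'I_n}) : v @: (i |: A) = v i |: v @: A.
Proof. by rewrite imsetU imset_set1. Qed.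

(** When all edges of [D] have more than [d] elements, these are the nonedges of the contraction at
    [v i], written without its minimality condition. *)
Definition link_nonedges d D i : {set {set 'I_n}} :=
  [set F : {set 'I_n} | [&& F \subset vertices D :\ i, #|F| == d
    & v @: (i |: F) \notin edges D]].

Lemma nonedges_split d D i : i \in vertices D ->
  nonedges d.+1 D =
  nonedges d.+1 (deletion D (v i)) :|: [set i |: F | F in link_nonedges d D i].
Proof.
move=> iD; apply/setP => A; apply/idP/setUP.
  move=> /nonedgesP[AD cA AE]; case iA: (i \in A); [right|left].
    apply/imsetP; exists (A :\ i); last by rewrite setD1K.
    rewrite inE setSD //= setD1K // AE andbT.
    by rewrite -eqSS -cA (cardsD1 i A) iA.
  apply/nonedgesP; rewrite /vertices vertices_delete subsetD1 AD iA cA; split=> //.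
  by rewrite inE (negPf AE).
case=> [/nonedgesP[]|/imsetP[F]].
  rewrite /vertices vertices_delete subsetD1 => /andP[AD iA] cA.
  rewrite inE negb_and negbK => AE; apply/nonedgesP; split=> //.
  by case/orP: AE => //; rewrite mem_imset // (negPf iA).
rewrite inE => /and3P[/subsetD1P[FD iF] /eqP cF FE ->].
by apply/nonedgesP; rewrite cardsU1 iF cF subUset sub1set iD FD.
Qed.

(** For distinct [g1] and [g2] in [G], if neither [G :\ g1] nor [G :\ g2] were in the link, both
    would form edges with [i]. Simpliciality then gives an edge inside [G], equal to [G] by size,
    although [G] is a nonedge. *)
Lemma simplicial_link_nonedge d D i G :
  (forall e, e \in edges D -> (d.+1 < #|e|)%N) -> i \in vertices D ->
  simplicial D (v i) -> G \in nonedges d.+2 (deletion D (v i)) ->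
  exists2 F, F \in link_nonedges d.+1 D i & F \subset G.
Proof.
move=> Dmin iD simp /nonedgesP[].
rewrite /vertices vertices_delete => /subsetD1P[GD iG] cG.
rewrite inE mem_imset // iG andbT => GE.
have edge g : g \in G -> G :\ g \notin link_nonedges d.+1 D i ->
    v @: (i |: G :\ g) \in edges D.
  move=> gG; rewrite inE subsetD1 !inE (negPf iG) andbF (subset_trans _ GD) ?subsetDl //=.
  by rewrite negb_and negbK -eqSS -cG (cardsD1 g G) gG eqxx.
have [g1 g1G] : exists g, g \in G by apply/card_gt0P; rewrite cG.
have [g2 g2G] : exists g, g \in G :\ g1.
  by apply/card_gt0P; move: cG; rewrite (cardsD1 g1 G) g1G; lia.
move: g2G; rewrite inE => /andP[]; rewrite inE => g12 g2G.
have [?|/(edge _ g1G) e1] := boolP (G :\ g1 \in link_nonedges d.+1 D i).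
  by exists (G :\ g1); rewrite ?subsetDl.
have [?|/(edge _ g2G) e2] := boolP (G :\ g2 \in link_nonedges d.+1 D i).
  by exists (G :\ g2); rewrite ?subsetDl.
have ne : v @: (i |: G :\ g1) != v @: (i |: G :\ g2).
  apply: contraTneq g1G => /(imset_inj v_inj)/setP/(_ g1).
  rewrite !inE eqxx [g1 == g2]eq_sym g12 /= orbF => e.
  by apply: contra iG => g1G; rewrite g1G orbT in e; rewrite -(eqP e).
have [e3 e3D] := simp _ _ e1 e2 ne (imset_f v (setU11 _ _)) (imset_f v (setU11 _ _)).
rewrite !imset_setU1 -setUUr => e3s; case/negP: GE.
suff <- : e3 = v @: G by [].
apply/eqP; rewrite eqEcard card_imset // cG Dmin // andbT.
apply: subset_trans e3s _; rewrite -imsetU subDset setUS //.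
by apply: imsetS; rewrite subUset !subsetDl.
Qed.

(** Induction on the number of vertices, through the deletion and the contraction at a simplicial
    vertex; both are minors, hence chordal. *)
Lemma chordal_linear_family d D : vset D \subset v @: [set: 'I_n] ->
  chordal D -> (forall e, e \in edges D -> (d <= #|e|)%N) ->
  exists p, linear_family (vertices D) d (nonedges d D) p.
Proof.
have [m] := ubnP #|vset D|; elim: m d D => // m IHm d D /ltnSE cD vD chD Dmin.
have famE N : nonedges d D = N -> forall p, linear_family (vertices D) d N p ->
    exists p, linear_family (vertices D) d (nonedges d D) p.
  by move=> -> p fam; exists p.
have [/eqP N0|/set0Pn[A AN]] := boolP (nonedges d D == set0).
  exact: famE N0 _ (LF_empty _ _).
have [AD cA AE] := elimT (nonedgesP _ _ _) AN.
case: d => [|d] in Dmin famE AN cA *.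
  have A0 : A = set0 by apply/cards0_eq.
  apply: (famE [set set0] _ 1%N); last exact: LF_unit.
  apply/setP => B; rewrite [RHS]inE; apply/nonedgesP/eqP => [[_ cB _]|->].
    exact: cards0_eq.
  by rewrite -A0.
(* It remains to choose [i] so that the link family is linear and lies below the deletion; the
   deletion itself is covered by induction. *)
suff [i iD [[pL famL] JL]] : exists2 i, i \in vertices D &
    (exists p, linear_family (vertices D :\ i) d (link_nonedges d D i) p) /\
    (forall G, G \in nonedges d.+1 (deletion D (v i)) ->
       exists2 F, F \in link_nonedges d D i & F \subset G).
  have [pJ famJ] : exists p, linear_family (vertices D :\ i) d.+1
      (nonedges d.+1 (deletion D (v i))) p.
    rewrite -vertices_delete; apply: (IHm _ (deletion D (v i))).
    - by move: iD cD; rewrite inE => iD; rewrite (cardsD1 (v i)) iD.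
    - exact: subset_trans (subsetDl _ _) vD.
    - apply: chordal_minor chD _; apply: minor_del (minor_refl _) _.
      by rewrite inE in iD.
    - by move=> e; rewrite inE => /andP[/Dmin].
  apply: (famE _ (nonedges_split _ iD) (maxn pJ.+1 pL)).
  apply: LF_step => //; apply: linear_family_gt0 famL _.
  (* The link is nonempty because [A] either comes from a member of it or contains one. *)
  move: AN; rewrite (nonedges_split _ iD) => /setUP[/JL[F FL _]|/imsetP[F FL _]];
    by apply/set0Pn; exists F.
(* For generators of size 1 a simplicial vertex may be a singleton edge, with empty link. A vertex
   [i] with [[set i]] a nonedge is taken instead: its link is the unit family, which lies below
   everything. *)
case: d => [|d] in Dmin famE AN cA *.
  have /cards1P[i AE1] : #|A| == 1%N by rewrite cA.
  exists i; first by rewrite (subsetP AD) // AE1 set11.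
  have -> : link_nonedges 0 D i = [set set0].
    apply/setP => F; rewrite !inE cards_eq0; case: eqP => [->|]; rewrite ?andbF //.
    by rewrite sub0set setU0 -AE1 AE.
  split; first by exists 1%N; apply: LF_unit.
  by move=> G _; exists set0; rewrite ?inE ?sub0set.
have [x xD simp] : exists2 x, x \in vset D & simplicial D x.
  apply: chD; first exact: minor_refl.
  have [i iA] : exists i, i \in A by apply/card_gt0P; rewrite cA.
  by apply/set0Pn; exists (v i); have := subsetP AD _ iA; rewrite inE.
have /imsetP[i _ xE] := subsetP vD _ xD; rewrite {x}xE in xD simp.
have iD : i \in vertices D by rewrite inE.
exists i => //; split; last first.
  by move=> G; apply: simplicial_link_nonedge.
have -> : link_nonedges d.+1 D i = nonedges d.+1 (contraction D (v i)).
  apply/setP => F; apply/idP/nonedgesP.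
    rewrite inE => /and3P[FD /eqP cF FE].
    rewrite /vertices vertices_delete; split=> //.
    have /subsetD1P[_ iF] := FD.
    rewrite (@contraction_edge d.+1) ?card_imset ?mem_imset //.
    by rewrite -imset_setU1.
  rewrite /vertices vertices_delete => -[FD cF FE].
  rewrite inE FD cF eqxx imset_setU1 /=.
  have /subsetD1P[_ iF] := FD.
  by rewrite -(@contraction_edge d.+1) ?card_imset ?mem_imset.
rewrite -vertices_delete; apply: (IHm _ (contraction D (v i))).
- by move: cD; rewrite (cardsD1 (v i)) xD.
- exact: subset_trans (subsetDl _ _) vD.
- by apply: chordal_minor chD _; apply: minor_contr (minor_refl _) _.
- by move=> e; apply: contraction_edge_card.
Qed.

End ChordalClutters.

(** * Monomials and edge ideals *)

(** Classical logic makes [P] boolean, so a bounded maximum exists. The bounds on [r] are returned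
    for the comparison of the two depths. *)
Lemma is_max_exists (P : nat -> Prop) b k :
  P k -> (forall i, P i -> (i <= b)%N) -> exists2 r, is_max P r & (k <= r <= b)%N.
Proof.
move=> Pk Pb; have exP : exists i, `[< P i >] by exists k; apply/asboolP.
have ubP i : `[< P i >] -> (i <= b)%N by move=> /asboolP /Pb.
case: (ex_maxnP exP ubP) => r /asboolP Pr rmax; exists r.
  by split=> // i Pi; apply: rmax; apply/asboolP.
by rewrite Pb // rmax //; apply/asboolP.
Qed.

Section SquarefreeMonomials.
Variable n : nat.
Implicit Types (m : 'X_{1..n}) (F G : {set 'I_n}).

Definition mnm_supp m : {set 'I_n} := [set i | m i != 0%N].

Definition sqfree_mnm F : 'X_{1..n} := [multinom (i \in F : nat) | i < n].

Lemma mnm_suppD m1 m2 : mnm_supp (m1 + m2) = mnm_supp m1 :|: mnm_supp m2.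
Proof. by apply/setP => i; rewrite !inE mnmDE addn_eq0 negb_and. Qed.

Lemma mnm_supp_sqfree F : mnm_supp (sqfree_mnm F) = F.
Proof. by apply/setP => i; rewrite inE mnmE; case: (i \in F). Qed.

Lemma sqfree_mnm_le F m : (sqfree_mnm F <= m)%MM = (F \subset mnm_supp m).
Proof.
apply/mnm_lepP/subsetP => [h i iF|h i]; first by have := h i; rewrite inE mnmE iF; lia.
rewrite mnmE; case iF: (i \in F) => //.
by have := h _ iF; rewrite inE; lia.
Qed.

Lemma mdeg_sqfree F : mdeg (sqfree_mnm F) = #|F|.
Proof.
by rewrite mdegE -sum1_card [RHS]big_mkcond; apply: eq_bigr => i _; rewrite mnmE; case: ifP.
Qed.

Lemma card_le_mdeg F m : F \subset mnm_supp m -> (#|F| <= mdeg m)%N.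
Proof.
rewrite -sqfree_mnm_le => le; rewrite -mdeg_sqfree !mdegE.
by apply: leq_sum => i _; apply/mnm_lepP.
Qed.

Lemma sqfree_mnmU1 i F : i \notin F ->
  sqfree_mnm (i |: F) = (U_(i) + sqfree_mnm F)%MM.
Proof.
move=> iF; apply/mnmP => j; rewrite mnmDE mnm1E !mnmE !inE eq_sym.
by case: eqP => // <-; rewrite (negPf iF).
Qed.

End SquarefreeMonomials.

(** * Membership of monomials in the edge ideal *)

Section EdgeIdealMonomials.
Variables (K : fieldType) (T : finType) (n : nat) (v : 'I_n -> T).
Variable D : clutter T.
Local Notation S := {mpoly K[n]}.
Implicit Types (f g : S) (m : 'X_{1..n}).

Definition generators : {set {set 'I_n}} := [set v @^-1: e | e : {set T} in edges D].

Definition in_ideal m := [exists F in generators, F \subset mnm_supp m].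

Lemma edge_monE e : edge_mon K v e = 'X_[sqfree_mnm (v @^-1: e)].
Proof.
rewrite [RHS]mpolyXE_id /edge_mon big_mkcond; apply: eq_bigr => i _.
by rewrite mnmE inE; case: ifP; rewrite ?expr0 ?expr1.
Qed.

(** The ideal is generated by squarefree monomials, so membership is decided monomial by monomial,
    and for each by its support alone. *)
Lemma edge_idealE f : (f \in edge_ideal v D) = all in_ideal (msupp f).
Proof.
apply/idP/allP => [/edge_idealP[c ->] m|h].
  move=> /msupp_sum_le/flatten_mapP[e]; rewrite mem_filter => /andP[eD _].
  rewrite edge_monE (perm_mem (msuppMX _ _)) => /mapP[m1 _ ->].
  apply/existsP; exists (v @^-1: e); rewrite imset_f //=.
  by rewrite mnm_suppD mnm_supp_sqfree subsetUl.
rewrite [f]mpolyE big_seq; apply: rpred_sum => m /h/existsP[F /andP[/imsetP[e eD ->] le]].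
apply/edge_idealP; exists (fun e' => if e' == e then
    f@_m *: 'X_[(m - sqfree_mnm (v @^-1: e))] else 0).
rewrite (bigD1 e) //= eqxx big1 ?addr0 => [|e' /andP[_ /negPf ->]]; last by rewrite mul0r.
by rewrite edge_monE -scalerAl -mpolyXD submK // sqfree_mnm_le.
Qed.

Lemma edge_proj_eq0P f : reflect (edge_proj v D f = 0) (all in_ideal (msupp f)).
Proof. by rewrite -edge_idealE; apply: (iffP idP) => /edge_proj_eq0. Qed.

End EdgeIdealMonomials.

(** * Upper bound on depth *)

Section DepthBound.
Variables (K : fieldType) (T : finType) (n : nat) (v : 'I_n -> T).
Variable D : clutter T.
Local Notation S := {mpoly K[n]}.
Local Notation X := (fun j : 'I_n => 'X_j : S).
Implicit Types (f g : S) (m : 'X_{1..n}) (y : {ffun {set 'I_n} -> S^o}).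

Definition proj_cochain y : {ffun {set 'I_n} -> edge_quot K v D} :=
  [ffun B => edge_proj v D (y B)].

Lemma koszul_proj y : koszul X (proj_cochain y) = proj_cochain (koszul X y).
Proof.
apply/ffunP => B; rewrite [RHS]ffunE !sum_ffunE edge_proj_sum.
apply: eq_bigr => j _; rewrite !ffunE.
case: ifP => _; first by rewrite -[pos_sign _ _ _ *: _]edge_projM -edge_projM.
by rewrite -[X in _ *: X](edge_proj0 K v D) -edge_projM.
Qed.

Lemma mcoeffXM0 d j g m : (forall m', (mdeg m' < d)%N -> g@_m' = 0) ->
  (mdeg m <= d)%N -> ('X_j * g)@_m = 0.
Proof.
move=> g0 md; apply/memN_msupp_eq0; rewrite mulrC (perm_mem (msuppMX _ _)).
apply/mapP => -[m1 m1g mE]; move: m1g; rewrite mcoeff_msupp g0 ?eqxx //.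
by move: md; rewrite mE mdegD mdeg1.
Qed.

(** Each term is multiplied by a variable, so the lowest degree rises by one. Hence nothing in the
    generating degree of the ideal bounds within the ideal. *)
Lemma mcoeff_koszul0 d y B m :
  (forall B' m', (mdeg m' < d)%N -> (y B')@_m' = 0) -> (mdeg m <= d)%N ->
  (koszul X y B)@_m = 0.
Proof.
move=> y0 md; rewrite sum_ffunE raddf_sum big1 // => j _.
rewrite ffunE; apply: mcoeffXM0 md => m' m'd; rewrite /wedge ffunE.
case: ifP => _; last by rewrite mcoeff0.
rewrite /pos_sign -signr_odd; case: (odd _); rewrite ?expr0 ?expr1 ?scale1r ?scaleN1r.
  by rewrite mcoeffN y0 ?oppr0.
by rewrite y0.
Qed.

Variable d : nat.
Hypothesis gen_deg : forall F, F \in generators v D -> #|F| = d.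

Lemma edge_ideal_mcoeff0 f m :
  f \in edge_ideal v D -> (mdeg m < d)%N -> f@_m = 0.
Proof.
rewrite edge_idealE => /allP fI md; apply/memN_msupp_eq0/negP => /fI.
move=> /existsP[F /andP[FN /card_le_mdeg]]; rewrite (gen_deg FN).
by rewrite leqNgt md.
Qed.

Lemma edge_proj1_neq0 : (0 < d)%N -> edge_proj v D (1 : S) <> 0.
Proof.
move=> d_gt0 /edge_proj_eq0 oneI.
have := edge_ideal_mcoeff0 (m := 0%MM) oneI; rewrite mdeg0 => /(_ d_gt0)/eqP.
by rewrite mcoeff1 eqxx oner_eq0.
Qed.

Lemma proj_cochain_lift (z : {ffun {set 'I_n} -> edge_quot K v D}) :
  exists y, z = proj_cochain y.
Proof.
have /choice[y yE] : forall B, exists f, z B = edge_proj v D f.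
  by move=> B; have [f zf] := quot_proj_surj (z B); exists f.
by exists [ffun B => y B]; apply/ffunP => B; rewrite !ffunE yE.
Qed.

Lemma proj_cochain_eq0 y : (forall B, y B \in edge_ideal v D) -> proj_cochain y = 0.
Proof.
by move=> yI; apply/ffunP => B; rewrite !ffunE; apply/edge_proj_eq0.
Qed.

Lemma proj_cochain_eq y1 y2 : proj_cochain y1 = proj_cochain y2 ->
  forall B, (y1 - y2) B \in edge_ideal v D.
Proof.
move=> e B; rewrite !ffunE; have /ffunP/(_ B) := e; rewrite !ffunE.
by move=> /quot_projE.
Qed.

(** The embedding of scalar cochains into one multidegree: adding [j] to [B] and multiplying by
    ['X_j] keep the form [B :\: U], which turns [delta] into [koszul]. *)
Definition mono_cochain (U : {set 'I_n}) (c : {ffun {set 'I_n} -> K^o}) :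
    {ffun {set 'I_n} -> S^o} :=
  [ffun B : {set 'I_n} => c B *: 'X_[sqfree_mnm (B :\: U)] : S].

Lemma koszul_mono (U : {set 'I_n}) (c : {ffun {set 'I_n} -> K^o}) :
  (forall B, c B != 0 -> U \subset B) ->
  koszul X (mono_cochain U c) = mono_cochain U (delta setT c).
Proof.
move=> cU; apply/ffunP => B; rewrite [RHS]ffunE !sum_ffunE scaler_suml.
apply: eq_bigr => j _; rewrite !ffunE inE scale1r.
case: ifP => jB; last by rewrite scaler0 scale0r.
have [->|/cU UB] := eqVneq (c (B :\ j)) 0; first by rewrite !(scaler0, scale0r).
have jU : j \notin U.
  by apply: contraTN UB => jU; apply/subsetPn; exists j; rewrite ?inE ?eqxx.
have -> : B :\: U = j |: ((B :\ j) :\: U).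
  by apply/setP => i; rewrite !inE; case: eqP => // ->; rewrite jB jU.
rewrite sqfree_mnmU1 ?inE ?eqxx ?andbF //= mpolyXD.
rewrite /pos_sign -signr_odd -[in RHS]signr_odd /GRing.scale /=.
(* Unfolding [GRing.scale] exposes the scaling by [K] as [mpoly_scale], whose laws are restated in
   that form. *)
have scaleA (a : K) (f g : S) : f * mpoly_scale a g = mpoly_scale a (f * g).
  exact: (esym (scalerAr a f g)).
have scaleN (a : K) (f : S) : mpoly_scale (- a) f = - mpoly_scale a f.
  exact: scaleNr.
by case: (odd _); rewrite ?expr0 ?expr1 ?mul1r ?mulN1r ?mulrN ?scaleN scaleA.
Qed.

(** This is the connecting map for [S/I]: a cocycle [c] on the ideal is [delta setT b], and [b]
    becomes a cocycle in the quotient, one degree lower. *)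
Lemma depth_bound p fs : (0 < d)%N ->
  linear_family setT d (generators v D) p ->
  (forall f, f \in fs -> irrelevant_ideal f) ->
  regular_sequence (edge_quot K v D) fs -> (size fs + p <= n)%N.
Proof.
move=> d_gt0 fam irr reg; have [p0|p_gt0] := posnP p.
  (* For [p = 0] the class is 1 in top degree [n]. Coboundaries have no constant term, and neither
     have elements of the ideal, as [0 < d]. *)
  pose y1 : {ffun {set 'I_n} -> S^o} := [ffun B => (B == setT)%:R].
  rewrite p0 addn0.
  apply: (@koszul_class_regular _ _ _ (proj_cochain y1)) reg => //.
  - move=> B; rewrite !ffunE; have [->|_] := eqVneq B setT; last by rewrite edge_proj0 eqxx.
    by rewrite cardsT card_ord.
  - rewrite koszul_proj; apply: proj_cochain_eq0 => B.
    rewrite sum_ffunE big1 ?rpred0 // => j _; rewrite !ffunE.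
    case: ifP => _; last by rewrite scaler0.
    rewrite (_ : B :\ j == setT = false) ?scaler0 //.
    by apply/negbTE; apply: contraTneq isT => /setP/(_ j); rewrite !inE eqxx.
  - move=> z'; have [y ->] := proj_cochain_lift z'; rewrite koszul_proj.
    move=> /proj_cochain_eq/(_ setT)/edge_ideal_mcoeff0 => /(_ 0%MM).
    rewrite mdeg0 => /(_ d_gt0)/eqP; rewrite ffunE mcoeffD ffunE eqxx mcoeff1 eqxx.
    rewrite ffunE mcoeffN (@mcoeff_koszul0 0) ?mdeg0 // subr0.
    by rewrite oner_eq0.
have [U [c [_ nz sc dc cU]]] := linear_family_cocycle K fam p_gt0.
have [B0 cB0] : exists B, c B != 0.
  apply/existsP; apply: contraNT nz => /existsPn c0.
  by apply/eqP/ffun_eq0P => B; rewrite (negPf (c0 B)).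
have [UB0 _ B0N] := sc _ cB0.
(* Positivity of [d] provides [w] outside [U]; contracting at it keeps [U] inside every face. *)
have [w wB0] : exists w, w \in B0 :\: U.
  by apply/card_gt0P; rewrite (gen_deg B0N).
have wU : w \notin U by move: wB0; rewrite inE => /andP[].
pose b := contract w c.
have db : delta setT b = c.
  by have := contract_delta c (in_setT w); rewrite dc linear0 add0r.
have bU B : b B != 0 -> U \subset B /\ (#|B| + 1 = d + #|U|)%N.
  move=> /contract_neq0[wB /sc[]]; rewrite subset_setU1_notin // => UB _ /gen_deg.
  have -> : (w |: B) :\: U = w |: (B :\: U).
    by apply/setP => i; rewrite !inE; case: eqP => // ->; rewrite wU.
  rewrite cardsU1 !inE wU (negPf wB) /= cardsDS // => <-; split=> //.
  by rewrite -addnA subnK ?subset_leq_card // addnC.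
clearbody b; pose y1 := mono_cochain U b.
have dy1 : koszul X y1 = mono_cochain U c.
  by rewrite koszul_mono ?db // => B /bU[].
(* The faces of [b] have [#|U| + d - 1] elements, which is [n - p] by [cU]. *)
suff : (size fs <= #|U| + d.-1)%N by rewrite cardsT card_ord in cU; lia.
apply: (@koszul_class_regular _ _ _ (proj_cochain y1)) reg => //.
- move=> B; rewrite !ffunE => nzB.
  have /bU[_] : b B != 0; last by lia.
  by apply: contraNneq nzB => ->; rewrite scale0r edge_proj0.
- rewrite koszul_proj dy1; apply: proj_cochain_eq0 => B; rewrite ffunE.
  have [->|cB] := eqVneq (c B) 0; first by rewrite scale0r rpred0.
  have [_ _ BN] := sc _ cB.
  rewrite edge_idealE; apply/allP => m /msuppZ_le; rewrite msuppX inE => /eqP ->.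
  by apply/existsP; exists (B :\: U); rewrite BN mnm_supp_sqfree subxx.
- move=> z'; have [y ->] := proj_cochain_lift z'; rewrite koszul_proj.
  (* If the class bounds, [q] has values in the ideal and [koszul X q] is the image of [c]. Its
     coefficient at [B0] has degree [d], so it vanishes, against [cB0]. *)
  move=> /proj_cochain_eq qI; set q := y1 - koszul X y in qI.
  have : koszul X q = mono_cochain U c.
    by rewrite linearB /= koszul_koszul subr0.
  move=> /ffunP/(_ B0)/(congr1 (mcoeff (sqfree_mnm (B0 :\: U)))).
  rewrite (@mcoeff_koszul0 d) ?mdeg_sqfree ?(gen_deg B0N) //; last first.
    by move=> B' m' ?; apply: edge_ideal_mcoeff0.
  rewrite ffunE mcoeffZ mcoeffX eqxx mulr1 => e.
  by rewrite -e eqxx in cB0.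
Qed.

End DepthBound.

(** * Lower bound on Stanley depth *)

(** Sets avoiding [v] are sorted by [NJ]. For a set containing [v], avoiding all generators amounts
    to its remainder avoiding [NL], since avoiding [NL] forces avoiding [NJ]. *)
Lemma linear_family_partition n (V : {set 'I_n}) d N p :
  linear_family V d N p ->
  exists (J : finType) (A B : J -> {set 'I_n}),
  [/\ forall j, [/\ A j \subset B j, B j \subset V & (#|V| <= #|B j| + p)%N],
      forall j F, F \in N -> ~~ (F \subset B j),
      forall G : {set 'I_n}, G \subset V -> (forall F, F \in N -> ~~ (F \subset G)) ->
        exists j, A j \subset G /\ G \subset B j
    & forall (G : {set 'I_n}) i j, A i \subset G -> G \subset B i ->
        A j \subset G -> G \subset B j -> i = j].
Proof.
elim=> {V d N p} [V d|V|V d v NJ NL pJ pL vV famJ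
    [J1 [A1 [B1 [AB1 avoid1 cover1 disj1]]]] famL
    [J2 [A2 [B2 [AB2 avoid2 cover2 disj2]]]] _ JL].
- exists unit, (fun=> set0), (fun=> V); split=> [_|_ F|G GV _|G [] []] //.
  + by rewrite sub0set subxx addn0.
  + by rewrite inE.
  + by exists tt; rewrite sub0set.
(* Every set contains [set0], so the unit family leaves nothing to partition. *)
- exists void, (fun=> set0), (fun=> V); split=> [[]|[]|G _ /(_ set0)|G []] //.
  by rewrite inE eqxx sub0set => /(_ isT).
have cV : #|V| = #|V :\ v|.+1 by rewrite (cardsD1 v V) vV.
have vB1 j : v \notin B1 j by have [_ /subsetD1P[]] := AB1 j.
have vA1 j : v \notin A1 j.
  by have [AB _ _] := AB1 j; apply: contra (vB1 j); apply: (subsetP AB).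
have vB2 j : v \notin B2 j by have [_ /subsetD1P[]] := AB2 j.
have vA2 j : v \notin A2 j.
  by have [AB _ _] := AB2 j; apply: contra (vB2 j); apply: (subsetP AB).
have JV F : F \in NJ -> v \notin F.
  by move=> /(linear_family_mem famJ)[/subsetD1P[]].
have LV F : F \in NL -> v \notin F.
  by move=> /(linear_family_mem famL)[/subsetD1P[]].
have vN (F G : {set 'I_n}) : v |: F \subset G -> v \in G.
  by rewrite subUset sub1set => /andP[].
pose A (j : J1 + J2) := match j with inl i => A1 i | inr i => v |: A2 i end.
pose B (j : J1 + J2) := match j with inl i => B1 i | inr i => v |: B2 i end.
exists (J1 + J2)%type, A, B; split.
- move=> [i|i] /=.
    have [AB BV cB] := AB1 i; rewrite AB (subset_trans BV) ?subsetDl //; split=> //.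
    by rewrite cV (leq_ltn_trans cB) // -addnS leq_add2l leq_maxl.
  have [AB BV cB] := AB2 i; rewrite setUS //; split=> //.
    by rewrite subUset sub1set vV (subset_trans BV) ?subsetDl.
  by rewrite cV cardsU1 vB2 /= addSn ltnS (leq_trans cB) // leq_add2l leq_maxr.
- move=> [i|i] F /setUP[FJ|/imsetP[F' F'L ->]] /=.
  + exact: avoid1.
  + by apply: contra (vB1 i); apply: vN.
  + rewrite subset_setU1_notin ?JV //; have [F' F'L F'F] := JL _ FJ.
    by apply: contra (avoid2 i _ F'L); apply: subset_trans.
  + rewrite subUset sub1set setU11 /= subset_setU1_notin ?LV //.
    exact: avoid2.
- move=> G GV Gavoid; have [vG|vG] := boolP (v \in G).
    have [|F FL|j [AG GB]] := cover2 (G :\ v); first exact: setSD.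
      apply: contra (Gavoid (v |: F) _); last by rewrite inE imset_f ?orbT.
      by rewrite subUset sub1set vG => /subset_trans; apply; apply: subsetDl.
    by exists (inr j); rewrite /= -(setD1K vG) !setUS.
  have [|F FJ|j AGB] := cover1 G; first by rewrite subsetD1 GV.
    by apply: Gavoid; rewrite inE FJ.
  by exists (inl j).
move=> G [i|i] [j|j] /= AG1 GB1 AG2 GB2.
- by congr inl; apply: disj1 GB1 _ GB2.
- by case/negP: (vB1 i); apply: (subsetP GB1); apply: vN AG2.
- by case/negP: (vB1 j); apply: (subsetP GB2); apply: vN AG1.
congr inr; apply: (disj2 (G :\ v)).
- by rewrite subsetD1 vA2 andbT (subset_trans _ AG1) ?subsetUr.
- by rewrite subDset.
- by rewrite subsetD1 vA2 andbT (subset_trans _ AG2) ?subsetUr.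
- by rewrite subDset.
Qed.

Section StanleyDecompositions.
Variables (K : fieldType) (T : finType) (n : nat) (v : 'I_n -> T).
Variable D : clutter T.
Local Notation S := {mpoly K[n]}.
Local Notation N := (generators v D).
Local Notation pi := (edge_proj v D : S -> edge_quot K v D).

Lemma poly_inD Z (f g : S) : poly_in Z f -> poly_in Z g -> poly_in Z (f + g).
Proof.
by move=> hf hg m /msuppD_le; rewrite mem_cat => /orP[/hf|/hg].
Qed.

Lemma poly_inN Z (f : S) : poly_in Z f -> poly_in Z (- f).
Proof. by move=> hf m; rewrite (perm_mem (msuppN _)) => /hf. Qed.

Lemma poly_in0 Z : poly_in Z (0 : S).
Proof. by move=> m; rewrite msupp0. Qed.

(** The monomials in the term of index [j] have supports between [A j] and [B j]. These intervals
    are disjoint and miss the ideal, so nothing cancels or dies. Both freeness and directness of the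
    sum follow. *)
Lemma intervals_independent k (A B : 'I_k -> {set 'I_n}) (q : 'I_k -> S) :
  (forall j, A j \subset B j) -> (forall j F, F \in N -> ~~ (F \subset B j)) ->
  (forall (G : {set 'I_n}) i j, A i \subset G -> G \subset B i ->
     A j \subset G -> G \subset B j -> i = j) ->
  (forall j, poly_in (B j) (q j)) ->
  \sum_j q j *: pi 'X_[sqfree_mnm (A j)] = 0 -> forall j, q j = 0.
Proof.
move=> AB avoid disj qB; under eq_bigr do rewrite -edge_projM.
rewrite -edge_proj_sum => /edge_proj_eq0P /allP sum_in j.
apply/eqP; rewrite -msupp_eq0; case mq: (msupp (q j)) => [|m s] //.
have {}mq : m \in msupp (q j) by rewrite mq inE eqxx.
have suppB i m' : m' \in msupp (q i) ->
    A i \subset mnm_supp (sqfree_mnm (A i) + m') /\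
    mnm_supp (sqfree_mnm (A i) + m') \subset B i.
  move=> m'q; rewrite mnm_suppD mnm_supp_sqfree subsetUl subUset AB; split=> //=.
  by apply/subsetP => l; rewrite inE; apply: qB m'q l.
have [Am mB] := suppB _ _ mq.
have : (sqfree_mnm (A j) + m)%MM \in msupp (\sum_j q j * 'X_[sqfree_mnm (A j)]).
  rewrite mcoeff_msupp raddf_sum (bigD1 j) //= mcoeffMX big1 ?addr0.
    by rewrite -mcoeff_msupp.
  move=> i ij; apply/memN_msupp_eq0; rewrite (perm_mem (msuppMX _ _)).
  apply: contra ij => /mapP[m' m'q e]; have [Am' mB'] := suppB _ _ m'q.
  by rewrite -e in Am' mB'; apply/eqP; apply: disj mB' Am mB.
move=> /sum_in/existsP[F /andP[FN Fm]].
by case/negP: (avoid j F FN); apply: subset_trans mB.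
Qed.

Lemma interval_stanley_space (A B : {set 'I_n}) :
  A \subset B -> (forall F, F \in N -> ~~ (F \subset B)) ->
  stanley_space (edge_grading K v D) (pi 'X_[sqfree_mnm A]) B.
Proof.
move=> AB avoid; split.
  exists [ffun i => (sqfree_mnm A i)%:Z], 'X_[sqfree_mnm A] => // m.
  by rewrite msuppX inE => /eqP -> i; rewrite ffunE.
exists 1%N, (fun=> pi 'X_[sqfree_mnm A]); split=> [_|w [q qB ->]].
  exists 1; last by rewrite scale1r.
  by move=> m; rewrite msupp1 inE => /eqP -> i; rewrite mnm0E.
exists [ffun=> q]; split=> [|c [cB]].
  by split=> [j|]; rewrite ?big_ord1 ffunE.
rewrite big_ord1 => /eqP; rewrite -subr_eq0 -scalerBl => /eqP e.
apply/ffunP => j; rewrite ffunE (ord1 j); apply/eqP; rewrite -subr_eq0; apply/eqP.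
apply: (@intervals_independent 1 (fun=> A) (fun=> B) (fun=> q - c ord0)) => //.
- by move=> G i1 i2; rewrite (ord1 i1) (ord1 i2).
- by move=> _; apply: poly_inD qB (poly_inN (cB _)).
- by rewrite big_ord1.
Qed.

Lemma interval_stanley_decomposition k (A B : 'I_k -> {set 'I_n}) :
  (forall j, A j \subset B j) -> (forall j F, F \in N -> ~~ (F \subset B j)) ->
  (forall G : {set 'I_n}, (forall F, F \in N -> ~~ (F \subset G)) ->
     exists j, A j \subset G /\ G \subset B j) ->
  (forall (G : {set 'I_n}) i j, A i \subset G -> G \subset B i ->
     A j \subset G -> G \subset B j -> i = j) ->
  stanley_decomposition (edge_grading K v D)
    (fun j => pi 'X_[sqfree_mnm (A j)]) B.
Proof.
move=> AB avoid cover disj; split=> [j|w].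
  by apply: interval_stanley_space => // F; apply: avoid.
(* Existence, one monomial at a time: [m] is zero in the quotient, or its support selects the
   interval [j] and [m] is divided by the monomial of [A j]. *)
have [q qB ->] : exists2 q : 'I_k -> S, forall j, poly_in (B j) (q j) &
    w = \sum_j q j *: pi 'X_[sqfree_mnm (A j)].
  have [f ->] := quot_proj_surj w; rewrite -/(pi f) {w}.
  rewrite [f]mpolyE; elim/big_ind: _ => [|f1 f2|m _].
  - exists (fun=> 0) => [j|]; first exact: poly_in0.
    by rewrite edge_proj0 big1 // => j _; rewrite scale0r.
  - move=> [q1 q1B e1] [q2 q2B e2]; exists (fun j => q1 j + q2 j).
      by move=> j; apply: poly_inD.
    rewrite edge_projD e1 e2 -big_split; apply: eq_bigr => j _.
    by rewrite scalerDl.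
  have [min|/existsPn mout] := boolP (in_ideal v D m).
    exists (fun=> 0) => [j|]; first exact: poly_in0.
    rewrite big1 => [|j _]; last by rewrite scale0r.
    apply/edge_proj_eq0P/allP => m' /msuppZ_le.
    by rewrite msuppX inE => /eqP ->.
  have [F FN|j [Aj Bj]] := cover (mnm_supp m).
    by have := mout F; rewrite FN.
  exists (fun i => if i == j then f@_m *: 'X_[(m - sqfree_mnm (A j))] else 0).
    move=> i; case: eqP => [->|_]; last exact: poly_in0.
    move=> m' /msuppZ_le; rewrite msuppX inE => /eqP -> l; rewrite mnmBE => ml.
    apply: (subsetP Bj); rewrite inE; apply: contraNneq ml => ->.
    by rewrite sub0n.
  rewrite (bigD1 j) //= eqxx big1 ?addr0 => [|i /negPf ->]; last by rewrite scale0r.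
  by rewrite -edge_projM -scalerAl -mpolyXD submK // sqfree_mnm_le.
exists [ffun j => q j *: pi 'X_[sqfree_mnm (A j)]]; split.
  split=> [j|]; first by rewrite ffunE; exists (q j).
  by apply: eq_bigr => j _; rewrite ffunE.
move=> f [fB fE]; have /choice[q' q'E] : forall j, exists p,
    poly_in (B j) p /\ f j = p *: pi 'X_[sqfree_mnm (A j)].
  by move=> j; have [p pB fp] := fB j; exists p.
apply/ffunP => j; rewrite ffunE; have [_ ->] := q'E j.
suff /eqP : q j - q' j = 0 by rewrite subr_eq0 => /eqP ->.
apply: (@intervals_independent k A B (fun j => q j - q' j)) => // [i|].
  by apply: poly_inD => //; apply: poly_inN; have [] := q'E i.
under eq_bigr do rewrite scalerBl.
rewrite sumrB fE; apply/eqP; rewrite subr_eq0; apply/eqP.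
by apply: eq_bigr => i _; have [_ ->] := q'E i.
Qed.

Lemma decomposition_sdepth_le k (Z : 'I_k -> {set 'I_n}) :
  (decomposition_sdepth Z <= n)%N.
Proof.
rewrite /decomposition_sdepth; elim/big_ind: _ => // [x y xn yn|j _].
  by rewrite geq_min xn.
by rewrite (leq_trans (max_card _)) ?card_ord.
Qed.

Lemma sdepth_bound d p : linear_family setT d N p ->
  exists k (u : 'I_k -> edge_quot K v D) (Z : 'I_k -> {set 'I_n}),
    stanley_decomposition (edge_grading K v D) u Z /\
    (n <= decomposition_sdepth Z + p)%N.
Proof.
move=> /linear_family_partition[J [A [B [AB avoid cover disj]]]].
exists #|J|, (fun j => pi 'X_[sqfree_mnm (A (enum_val j))]),
  (fun j => B (enum_val j)); split.
  apply: interval_stanley_decomposition => [j|j F|G /cover[]|G i j A1 B1 A2 B2].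
  - by have [] := AB (enum_val j).
  - exact: avoid.
  - exact: subsetT.
  - by move=> j AGB; exists (enum_rank j); rewrite enum_rankK.
  - by apply/enum_val_inj/(disj G).
(* The initial value [n] of the minimum is also at least [n - p]. *)
rewrite addnC -leq_subLR /decomposition_sdepth.
elim/big_ind: _ => [|x y xn yn|j _]; first exact: leq_subr.
  by rewrite leq_min xn.
by have [_ _] := AB (enum_val j); rewrite cardsT card_ord leq_subLR addnC.
Qed.

End StanleyDecompositions.

(** * Comparison of depth and Stanley depth *)

Lemma generators_d_complement (T : finType) n (v : 'I_n -> T) (C : clutter T) d :
  injective v -> vset C = [set v i | i : 'I_n] ->
  generators v (d_complement d C) = nonedges v d C.
Proof.
move=> v_inj vE; apply/setP => A; rewrite [RHS]inE; apply/imsetP/idP => [[e eC ->]|AC].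
  suff -> : v @: (v @^-1: e) = e by [].
  apply/setP => x; apply/imsetP/idP => [[i]|xe]; first by rewrite inE => ? ->.
  have : x \in vset C by apply: (subsetP (compl_sub eC)).
  by rewrite vE => /imsetP[i _ xi]; exists i; rewrite // inE -xi.
by exists (v @: A) => //; apply/setP => i; rewrite inE mem_imset.
Qed.

Theorem theorem2p7 (K : fieldType) (T : finType) (n : nat) (C : clutter T)
    (v : 'I_n -> T) (v_inj : injective v) (vE : vset C = [set v i | i : 'I_n])
    (d : nat) (d_ge1 : (1 <= d)%N) (C_chordal : chordal C)
    (C_min : forall e : {set T}, e \in edges C -> (d <= #|e|)%N) :
  exists r s : nat,
    [/\ has_depth (edge_quot K v (d_complement d C)) r,
        has_sdepth (edge_grading K v (d_complement d C)) s
      & (r <= s)%N].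
Proof.
have [|p fam] := chordal_linear_family v_inj _ C_chordal C_min.
  by rewrite vE; apply/subsetP => x /imsetP[i _ ->]; apply: imset_f.
have verT : vertices v C = setT.
  by apply/setP => i; rewrite !inE vE imset_f.
rewrite verT -(generators_d_complement d v_inj vE) in fam.
have deg F : F \in generators v (d_complement d C) -> #|F| = d.
  by move=> /(linear_family_mem fam)[].
(* The depth exists: the empty sequence qualifies because 1 is not in the ideal, and all lengths are
   at most [n - p]. *)
have [||r r_max /andP[_ r_le]] := @is_max_exists
  (fun r => exists fs : seq {mpoly K[n]}, [/\ size fs = r,
    forall f, f \in fs -> irrelevant_ideal f
    & regular_sequence (edge_quot K v (d_complement d C)) fs]) (n - p)%N 0%N.
- exists [::]; split=> //; split=> //; exists (edge_proj v (d_complement d C) 1).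
  by case=> y; rewrite big_ord0; apply: edge_proj1_neq0 deg d_ge1.
- move=> r [fs [<- irr reg]].
  have le := depth_bound deg d_ge1 fam irr reg.
  by rewrite leq_subRL ?(leq_trans (leq_addl _ _) le) // addnC.
have [k [u [Z [decZ leZ]]]] := sdepth_bound K fam.
have [||s s_max /andP[s_ge _]] := @is_max_exists
  (fun s => exists k (u : 'I_k -> edge_quot K v (d_complement d C)) Z,
    stanley_decomposition (edge_grading K v (d_complement d C)) u Z /\
    decomposition_sdepth Z = s) n (decomposition_sdepth Z).
- by exists k, u, Z.
- by move=> _ [k' [u' [Z' [_ <-]]]]; apply: decomposition_sdepth_le.
(* The chain is [r <= n - p <= decomposition_sdepth Z <= s]. *)
exists r, s; split=> //; apply: leq_trans r_le (leq_trans _ s_ge).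
by rewrite leq_subLR addnC.
Qed.
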